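(* For every integer $r \ge 3$ and every $\varepsilon > 0$ there exists an integer $n_0 = n_0(r,\varepsilon)$ such that every edge-coloured graph $G$ on $n \ge n_0$ vertices with $n \equiv 0 \pmod{r}$ and \[ \delta^c(G) \ge \begin{cases} (5/6 + \varepsilon) n & \text{if } r = 3,\\ \left(2+\sqrt{13/2}+ \varepsilon\right)n/5 & \text{if } r = 4,\\ \left(1- \frac{1}{(2r-3)r}+ \varepsilon \right) n & \text{if } r \ge 5, \end{cases} \] contains a perfect rainbow-$K_r$-tiling.
   Context: An edge-coloured graph is a (finite, simple) graph $G$ together with an assignment $c$ of a colour to each edge. For a vertex $v$, the colour degree $d^c(v)$ is the number of distinct colours on edges incident to $v$, and the minimum colour degree $\delta^c(G)$ is the minimum of $d^c(v)$ over all vertices $v$. A subgraph is rainbow if all its edges have distinct colours. A rainbow-$K_r$-tiling is a collection of vertex-disjoint rainbow copies of $K_r$ in $G$ (colours may repeat between different copies); it is perfect if it covers every vertex of $G$. *)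

(* Defs.v *)
From HB Require Import structures.
From mathcomp Require Import all_boot all_order all_algebra.
From mathcomp Require Import reals.

Set Implicit Arguments.
Unset Strict Implicit.
Unset Printing Implicit Defensive.

Import Order.TTheory GRing.Theory Num.Theory.

(* An edge is the unordered pair [set x; y] of its endpoints. The value of
   ecg_col is only ever used on edges; it is arbitrary on other sets. *)
Record ecgraph (T : finType) (C : eqType) := ECGraph {
  ecg_adj : rel T;
  ecg_sym : symmetric ecg_adj;
  ecg_irr : irreflexive ecg_adj;
  ecg_col : {set T} -> C
}.

Section EdgeColouredGraphs.
Variables (T : finType) (C : eqType) (G : ecgraph T C).

Definition edges : {set {set T}} :=
  [set [set p.1; p.2] | p : T * T & ecg_adj G p.1 p.2].

Definition colour_degree (v : T) : nat :=
  size (undup [seq ecg_col G [set v; u] | u in [pred u | ecg_adj G v u]]).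

(* Every colour degree is smaller than #|T|, so the default value #|T| does
   not affect the minimum unless T is empty. *)
Definition min_colour_degree : nat :=
  \big[minn/#|T|]_(v : T) colour_degree v.

Definition rainbow (F : {set {set T}}) : Prop :=
  {in F &, injective (ecg_col G)}.

Definition is_clique (A : {set T}) : Prop :=
  {in A &, forall x y, x != y -> ecg_adj G x y}.

(* A copy of K_r is determined by its vertex set A; its edges are the edges
   of G contained in A. *)
Definition rainbow_Kr (r : nat) (A : {set T}) : Prop :=
  [/\ #|A| = r, is_clique A & rainbow [set E in edges | E \subset A]].

Definition rainbow_Kr_tiling (r : nat) (P : {set {set T}}) : Prop :=
  trivIset P /\ {in P, forall A, rainbow_Kr r A}.

Definition perfect_rainbow_Kr_tiling (r : nat) (P : {set {set T}}) : Prop :=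
  rainbow_Kr_tiling r P /\ cover P = [set: T].

End EdgeColouredGraphs.

Local Open Scope ring_scope.

Definition degree_bound (R : realType) (r : nat) (eps : R) (n : nat) : R :=
  if r == 3%N then (5 / 6 + eps) * n%:R
  else if r == 4%N then (2 + Num.sqrt (13 / 2) + eps) * n%:R / 5
  else (1 - 1 / ((2 * r%:R - 3) * r%:R) + eps) * n%:R.

(* Main.v *)
Require Import Defs.
From HB Require Import structures.
From mathcomp Require Import all_boot all_order all_algebra.
From mathcomp Require Import reals.
From mathcomp Require Import zify ring lra.

Set Implicit Arguments.
Unset Strict Implicit.
Unset Printing Implicit Defensive.

Import Order.TTheory GRing.Theory Num.Theory.

(* Fix at every vertex v a rainbow star R v with one edge of each colour, so
   that at most D vertices lie outside R v. Cliques are grown greedily inside a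
   set X of candidates: picking u in X loses the vertices outside R u, and those
   w for which the edge w u repeats at w the colour of an edge from w to the
   current clique. As each w allows only D + O(1) such u, some (indeed many) u
   lose at most 2 D + O(1) candidates.

   Absorption. The greedy argument gives, for any two vertices x and y, many
   (r-1)-sets S such that S + x and S + y are both rainbow cliques. Hence every
   r-tuple l has many absorbers: a rainbow clique a_1 ... a_r together with sets
   S_i such that S_i + a_i and S_i + l_i are rainbow cliques. A greedy choice,
   controlled by the sum over l of 2 ^ - (number of absorbers of l chosen so
   far), yields a small disjoint family with linearly many absorbers of each l.

   Almost perfect tiling. For every weight y on the vertices there is a rainbow
   clique of at most average weight: the greedy argument is run inside prefixes
   of the vertices ordered by weight. Cliques are then removed one at a time, y
   being the gradient of a fourth-moment potential which controls the
   proportion of the remaining vertices that lie outside each R v; as these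
   proportions hardly change, the process runs until few vertices are left. *)

(** * Rainbow cliques as sequences, and rainbow stars *)

Lemma rainbow_representatives (T C : eqType) (f : T -> C) (s : seq T) :
  exists s' : seq T, [/\ {subset s' <= s}, uniq (map f s') &
    size s' = size (undup (map f s))].
Proof.
elim: s => [|x s [s' [sub us' szs']]]; first by exists [::].
rewrite /=; case: ifP => fx.
  by exists s'; split=> // y /sub ys; rewrite inE ys orbT.
exists (x :: s'); split=> /=; last by rewrite szs'.
- move=> y; rewrite !inE => /orP [->//|/sub ->]; by rewrite orbT.
- rewrite us' andbT; apply/negP => /mapP [y /sub ys fxy].
  by move/negP: fx; apply; rewrite fxy map_f.
Qed.

Section Graph.
Variables (T : finType) (C : eqType) (G : ecgraph T C).
Local Notation adj := (ecg_adj G).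

Definition ecol (x y : T) : C := ecg_col G [set x; y].

Lemma ecol_sym x y : ecol x y = ecol y x.
Proof. by rewrite /ecol setUC. Qed.

Fixpoint cols (K : seq T) : seq C :=
  if K is u :: K' then [seq ecol u v | v <- K'] ++ cols K' else [::].

(** Rainbow cliques are kept as sequences so that they grow by [cons]; [valid_rainbow_Kr] returns to
    vertex sets. *)
Definition valid (K : seq T) : bool := pairwise adj K && uniq (cols K).

Lemma valid_consE u K :
  valid (u :: K) =
  [&& all (adj u) K, uniq ([seq ecol u v | v <- K] ++ cols K) & pairwise adj K].
Proof. by rewrite /valid /= -!andbA; congr andb; rewrite andbC. Qed.

Lemma valid_tail u K : valid (u :: K) -> valid K.
Proof.
rewrite valid_consE => /and3P [_ uc pK].
by rewrite /valid pK; move: uc; rewrite cat_uniq => /and3P [].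
Qed.

Lemma size_cols K : (size (cols K) <= size K ^ 2)%N.
Proof. by elim: K => //= u K IH; rewrite size_cat size_map; nia. Qed.

Lemma valid_uniq K : valid K -> uniq K.
Proof.
rewrite /valid => /andP [pK _]; elim: K pK => //= u K IH /andP [au pK].
rewrite IH // andbT; apply/negP => uK.
by move/allP: au => /(_ u uK); rewrite ecg_irr.
Qed.

Lemma valid_adj K : valid K -> {in K &, forall x y, x != y -> adj x y}.
Proof.
elim: K => //= u K IH vK x y; rewrite !inE.
have vK' := valid_tail vK.
move: vK; rewrite valid_consE => /and3P [/allP au _ _].
move=> /orP [/eqP->|xK] /orP [/eqP->|yK] xy; first by rewrite eqxx in xy.
- exact: au.
- by rewrite ecg_sym; apply: au.
- exact: IH.
Qed.

Lemma cols_mem K x y : x \in K -> y \in K -> x != y -> ecol x y \in cols K.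
Proof.
elim: K => //= u K IH; rewrite !inE mem_cat.
move=> /orP [/eqP->|xK] /orP [/eqP->|yK] xy; first by rewrite eqxx in xy.
- by rewrite map_f.
- by rewrite ecol_sym map_f.
- by rewrite IH ?orbT.
Qed.

(** By induction: uniqueness of [cols] makes the colours at the head distinct from one another
    ([inju]) and from those of the tail ([nd]). *)
Lemma valid_col_inj K x y x' y' : valid K ->
  x \in K -> y \in K -> x != y -> x' \in K -> y' \in K -> x' != y' ->
  ecol x y = ecol x' y' -> [set x; y] = [set x'; y'].
Proof.
elim: K x y x' y' => //= u K IH x y x' y' vK.
have vK' := valid_tail vK.
move: vK; rewrite valid_consE cat_uniq => /and3P [_ /and3P [uu disj _] _].
have inju v w : v \in K -> w \in K -> ecol u v = ecol u w -> v = w.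
  move=> vK wK; elim: K uu vK wK {disj IH vK'} => //= a K IHK /andP [na uK].
  rewrite !inE => /orP [/eqP->|vK] /orP [/eqP->|wK] // e.
  - by move/negP: na; case; rewrite e map_f.
  - by move/negP: na; case; rewrite -e map_f.
  - exact: IHK.
have nd v w z : v \in K -> w \in K -> z \in K -> w != z -> ecol u v <> ecol w z.
  move=> vK wK zK wz e; move/hasPn: disj => /(_ (ecol w z)).
  rewrite (cols_mem wK zK wz) -e map_f // => /(_ isT) //.
rewrite !inE => /orP [/eqP->|xK] /orP [/eqP->|yK] xy
  /orP [/eqP->|xK'] /orP [/eqP->|yK'] xy' e;
  rewrite ?eqxx in xy xy'; rewrite //.
- by rewrite (inju _ _ yK yK' e).
- by rewrite (inju y x') // 1?setUC // e ecol_sym.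
- by case: (nd _ _ _ yK xK' yK' xy' e).
- by rewrite (inju x y') // 1?setUC // -e ecol_sym.
- by rewrite (inju x x') // ecol_sym e ecol_sym.
- by case: (nd x x' y') => //; rewrite ecol_sym.
- by case: (nd y' x y).
- by case: (nd x' x y) => //; rewrite ecol_sym.
- exact: IH.
Qed.

Lemma valid_rainbow_Kr K : valid K -> rainbow_Kr G (size K) [set x in K].
Proof.
move=> vK; split.
- by rewrite cardsE; apply/card_uniqP/valid_uniq.
- by move=> x y; rewrite !inE; apply: valid_adj.
- move=> E E'; rewrite !inE => /andP [/imsetP [[x y] /= axy ->] sub].
  move=> /andP [/imsetP [[x' y'] /= axy' ->] sub'] e.
  have ne a b : adj a b -> a != b.
    by apply: contraTneq => ->; rewrite ecg_irr.
  rewrite !inE /= in axy axy'.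
  move/subsetP: sub => sub; move/subsetP: sub' => sub'.
  have inK z : z \in [set x; y] -> z \in K by move/sub; rewrite inE.
  have inK' z : z \in [set x'; y'] -> z \in K by move/sub'; rewrite inE.
  apply: (valid_col_inj vK) e; rewrite ?ne //.
  - by apply: inK; rewrite set21.
  - by apply: inK; rewrite set22.
  - by apply: inK'; rewrite set21.
  - by apply: inK'; rewrite set22.
Qed.


Lemma rainbow_star_exists v : exists S : {set T},
  [/\ {in S, forall u, adj v u}, {in S &, injective (ecol v)} &
    #|S| = colour_degree G v].
Proof.
have [s' [sub us sz]] :=
  rainbow_representatives (ecol v) (enum [pred u | adj v u]).
have us' : uniq s' by apply: map_uniq us.
exists [set u in s']; split.
- by move=> u; rewrite inE => /sub; rewrite mem_enum inE.
- move=> u w; rewrite !inE => us0 ws0 e.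
  elim: s' us us0 ws0 e {sub sz us'} => //= a s IH /andP [na us].
  rewrite !inE => /orP [/eqP->|vs] /orP [/eqP->|ws] // e.
  + by move/negP: na; case; rewrite e map_f.
  + by move/negP: na; case; rewrite -e map_f.
  + exact: IH.
- by rewrite cardsE (card_uniqP us') sz.
Qed.

(** * Greedy extension of cliques inside rainbow stars *)

Definition rainbow_stars (R : T -> {set T}) : Prop :=
  (forall v, {in R v, forall u, adj v u}) /\
  (forall v, {in R v &, injective (ecol v)}).

(** For rainbow stars [v] itself counts towards [D], since [R v] contains only neighbours of [v]. *)
Definition deficiency (R : T -> {set T}) (U : {set T}) (D : nat) : Prop :=
  {in U, forall v, #|U :\: R v| <= D}.

(** [Ks] lists cliques to be extended by the same vertices: two when vertices [x] and [y] are to be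
    exchanged, one otherwise. *)
Definition nextc (R : T -> {set T}) (Ks : seq (seq T)) (X : {set T}) (u : T) :=
  [set w in X | (w \in R u) && all (fun K => valid (w :: u :: K)) Ks].

(* As the edges from v to R v have distinct colours, asking that w lie in R v
   bounds the number of w lost to a given number of forbidden colours at v. *)
Definition cand (R : T -> {set T}) (Ks : seq (seq T)) (X : {set T}) : Prop :=
  {in X, forall w, {in Ks, forall K,
     valid (w :: K) /\ {in K, forall v, w \in R v}}}.

Section Stars.
Variables (R : T -> {set T}) (hR : rainbow_stars R).

Lemma star_col_le v (X : {set T}) (s : seq C) :
  #|[set w in X | (w \in R v) && (ecol v w \in s)]| <= size s.
Proof.
set A := [set _ in X | _].
have -> : #|A| = size [seq ecol v w | w <- enum A] by rewrite size_map -cardE.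
apply: uniq_leq_size.
  rewrite map_inj_in_uniq ?enum_uniq // => x y.
  rewrite !mem_enum !inE => /and3P [_ xR _] /and3P [_ yR _].
  exact: (proj2 hR v).
by move=> c /mapP [w]; rewrite mem_enum inE => /and3P [_ _ ?] ->.
Qed.

Lemma bad_col_le (U Y : {set T}) D w (s : seq C) :
  deficiency R U D -> w \in U -> Y \subset U ->
  #|[set u in Y | (u \notin R w) || (ecol w u \in s)]| <= D + size s.
Proof.
move=> hD wU /subsetP YU.
apply: (leq_trans _ (leq_add (hD w wU) (star_col_le w Y s))).
apply: (leq_trans _ (leq_card_setU _ _)); apply: subset_leq_card.
apply/subsetP => u; rewrite !inE => /andP [uY h]; rewrite uY (YU _ uY) /=.
by case: (u \in R w) h => //= ->.
Qed.

Lemma nextc_cand Ks X u : cand R Ks X -> cand R (map (cons u) Ks) (nextc R Ks X u).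
Proof.
move=> hX w; rewrite inE => /and3P [wX wR /allP v] _ /mapP [K KK ->].
split; first exact: v.
by move=> z; rewrite inE => /orP [/eqP->//|]; apply: (proj2 (hX w wX K KK)).
Qed.

Lemma nextc_sub Ks X u : nextc R Ks X u \subset X.
Proof. by apply/subsetP => w; rewrite inE => /andP []. Qed.

(** As [w :: K] and [u :: K] are valid, a colour can only be repeated by the edge [w u] or by an
    edge at [w] together with one at [u]. The first colour condition is read at [w], the other two
    at [u] and at the vertices of [K], whose stars contain [w]. *)
Lemma valid_cons2 w u K : w \in R u -> valid (w :: K) -> valid (u :: K) ->
  {in K, forall v, w \in R v} ->
  ecol w u \notin [seq ecol w v | v <- K] ->
  ecol u w \notin [seq ecol u v | v <- K] ++ cols K ->
  {in K, forall v, ecol v w \notin [seq ecol u v' | v' <- K]} ->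
  valid (w :: u :: K).
Proof.
move=> wu vw vu wK c1 c2 c3.
have awu : adj w u by rewrite ecg_sym; apply: (proj1 hR u).
move: vw vu; rewrite !valid_consE /= => /and3P [aw uw pK] /and3P [au uu _].
rewrite awu aw au pK /= !andbT mem_cat negb_or c1 /= ecol_sym c2 /=.
rewrite cat_uniq uu andbT; move: uw; rewrite cat_uniq => /and3P [-> h _] /=.
rewrite -all_predC; apply/allP => c; rewrite mem_cat => /orP [cu|cK] /=.
  apply/negP => /mapP [v vK e]; move: (c3 v vK).
  by rewrite ecol_sym -e cu.
by move/hasPn: h => /(_ c cK).
Qed.

(** Bounds the losses due to coinciding colours, at most [2 * (r + r ^ 2) + 4 * r ^ 2] for two
    cliques of size at most [r]. *)
Definition slack r := 8 * r ^ 2.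

Lemma card_has_le (X : {set T}) (I : eqType) (P : T -> I -> bool) (s : seq I) :
  #|[set w in X | has (P w) s]| <= \sum_(v <- s) #|[set w in X | P w v]|.
Proof.
elim: s => [|v s IH]; first by rewrite big_nil leqn0 cards_eq0; apply/eqP/setP => w;
  rewrite !inE andbF.
rewrite big_cons; apply: (leq_trans _ (leq_add (leqnn _) IH)).
apply: (leq_trans _ (leq_card_setU _ _)); apply: subset_leq_card.
by apply/subsetP => w; rewrite !inE /= => /andP [-> /orP [->|->]] //=; rewrite orbT.
Qed.

Lemma sum_seq_le (I : eqType) (s : seq I) (F : I -> nat) B :
  {in s, forall i, F i <= B} -> \sum_(i <- s) F i <= size s * B.
Proof.
move=> h; apply: (leq_trans (n := \sum_(i <- s) B)).
  by rewrite big_seq [X in _ <= X]big_seq; apply: leq_sum => i /h.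
by rewrite big_const_seq count_predT iter_addn addn0 mulnC.
Qed.

(** Double counting of the pairs where picking [u] loses [w]. For fixed [u], at most [D] of the [w]
    lie outside [R u], and boundedly many meet a colour forbidden at [u] or at a clique vertex. The
    other losses, where [w u] repeats a colour from [w] to a clique, are counted from [w], which
    allows at most [D + 2 * r] such [u]. *)
Lemma lost_le (U X Y : {set T}) D Ks r :
  deficiency R U D -> X \subset U -> Y \subset U ->
  cand R Ks X -> cand R Ks Y ->
  size Ks <= 2 -> {in Ks, forall K, size K <= r} ->
  \sum_(u in Y) #|X :\: nextc R Ks X u| <= (#|X| + #|Y|) * (D + slack r).
Proof.
move=> hD XU YU hX hY sK sr.
pose c1s w := flatten [seq [seq ecol w v | v <- K] | K <- Ks].
pose c2s w := flatten [seq [seq ecol w v | v <- K] ++ cols K | K <- Ks].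
pose f1 u := [set w in U | w \notin R u].
pose f2 u := [set w in X | (w \in R u) && (ecol u w \in c2s u)].
pose f3 u := [set w in X | has (fun v => (w \in R v) && (ecol v w \in c1s u)) (flatten Ks)].
pose inm u := [set w in X | ecol w u \in c1s w].
have bnd (I : Type) (g : seq T -> seq I) B :
    {in Ks, forall K, size (g K) <= B} -> size (flatten [seq g K | K <- Ks]) <= 2 * B.
  move=> hg; rewrite size_flatten /shape -map_comp sumnE big_map.
  apply: (leq_trans (sum_seq_le (B := B) _)); last by rewrite leq_mul2r sK orbT.
  by move=> K /hg.
have sz1 w : size (c1s w) <= 2 * r.
  by apply: bnd => K KK; rewrite size_map sr.
have sz2 w : size (c2s w) <= 2 * (r + r ^ 2).
  apply: bnd => K KK; rewrite size_cat size_map leq_add ?sr //.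
  by apply: (leq_trans (size_cols K)); rewrite leq_exp2r ?sr.
have sz3 : size (flatten Ks) <= 2 * r.
  by rewrite -[Ks]map_id; apply: bnd.
set B := 2 * (r + r ^ 2) + 2 * r * (2 * r).
have lost u : u \in Y -> #|X :\: nextc R Ks X u| <= #|inm u| + (D + B).
  move=> uY; apply: (leq_trans (n := #|inm u :|: (f1 u :|: (f2 u :|: f3 u))|)).
    apply: subset_leq_card; apply/subsetP => w; rewrite !inE negb_and negb_and.
    move=> /andP [/orP [/negbTE->//|h] wX]; rewrite wX /= (subsetP XU) //=.
    move: h; case wu: (w \in R u) => //=; last by rewrite orbT.
    rewrite -has_predC => /hasP [K KK /= nv].
    have mf (g : seq T -> seq C) c : c \in g K -> c \in flatten [seq g K | K <- Ks].
      by move=> ?; apply/flattenP; exists (g K) => //; apply: map_f.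
    apply/or3P; case: (boolP (ecol w u \in _)) => [|d1]; first by constructor.
    case: (boolP (ecol u w \in _)) => [|d2]; first by constructor.
    constructor 3; apply/negPn/negP => /hasPn d3; move/negP: nv; apply.
    have [vw wK] := hX w wX K KK; have [vu uK] := hY u uY K KK.
    apply: valid_cons2 => //.
    - by apply: contra d1; apply: (mf (fun K => [seq ecol w v | v <- K])).
    - by apply: contra d2; apply: (mf (fun K => [seq ecol u v | v <- K] ++ cols K)).
    - move=> v vK; apply/negP => d4; have := d3 v.
      rewrite wK //= (mf (fun K => [seq ecol u v | v <- K])) //.
      have -> : v \in flatten Ks by apply/flattenP; exists K.
      by move=> /(_ isT).
  apply: (leq_trans (leq_card_setU _ _)); rewrite leq_add2l.
  apply: (leq_trans (leq_card_setU _ _)); apply: leq_add.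
    apply: (leq_trans _ (hD u (subsetP YU u uY))).
    by apply: subset_leq_card; apply/subsetP => w; rewrite !inE andbC.
  apply: (leq_trans (leq_card_setU _ _)); apply: leq_add.
    exact: (leq_trans (star_col_le _ _ _)).
  apply: (leq_trans (card_has_le _ _ _)).
  apply: (leq_trans (sum_seq_le (B := 2 * r) _)); last by rewrite leq_mul2r sz3 orbT.
  by move=> v _; apply: (leq_trans (star_col_le _ _ _)).
apply: (leq_trans (n := \sum_(u in Y) (#|inm u| + (D + B)))); first exact: leq_sum.
rewrite big_split /= sum_nat_const.
have : \sum_(u in Y) #|inm u| <= #|X| * (D + 2 * r).
  have -> : \sum_(u in Y) #|inm u| = \sum_(w in X) #|[set u in Y | ecol w u \in c1s w]|.
    under eq_bigr do rewrite -sum1_card.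
    under [RHS]eq_bigr do rewrite -sum1_card.
    rewrite (exchange_big_dep (fun w => w \in X)) /=; last by move=> u w _; rewrite inE => /andP [].
    apply: eq_bigr => w wX; apply: eq_bigl => u; rewrite !inE wX //.
  rewrite -sum_nat_const; apply: leq_sum => w wX.
  apply: (leq_trans _ (leq_trans (bad_col_le (c1s w) hD (subsetP XU w wX) YU) _)).
    by apply: subset_leq_card; apply/subsetP => u; rewrite !inE => /andP [-> ->]; rewrite orbT.
  by rewrite leq_add2l.
move=> h; apply: (leq_trans (leq_add h (leqnn _))).
rewrite mulnDl leq_add // leq_mul2l leq_add2l /slack /B; apply/orP; right; nia.
Qed.

Lemma nextc_card Ks X u : #|nextc R Ks X u| + #|X :\: nextc R Ks X u| = #|X|.
Proof. by rewrite -(cardsID (nextc R Ks X u) X) (setIidPr (nextc_sub Ks X u)). Qed.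

Lemma pick_exists (U X Y : {set T}) D Ks r :
  deficiency R U D -> X \subset U -> Y \subset U ->
  cand R Ks X -> cand R Ks Y ->
  size Ks <= 2 -> {in Ks, forall K, size K <= r} -> 0 < #|Y| ->
  exists2 u, u \in Y &
    #|Y| * #|X :\: nextc R Ks X u| <= (#|X| + #|Y|) * (D + slack r).
Proof.
move=> hD XU YU hX hY sK sr /card_gt0P [u0 u0Y].
have [u uY um] := arg_minnP (fun u => #|X :\: nextc R Ks X u|) u0Y.
exists u => //; apply: leq_trans (lost_le hD XU YU hX hY sK sr).
by rewrite -sum_nat_const; apply: leq_sum => v vY; apply: um.
Qed.

(** If fewer than [b] vertices were good, each of the others would lose more than
    [2 * (D + slack r) + b], and together they would exceed the total of [lost_le]. *)
Lemma pick_many (U X : {set T}) D Ks r b :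
  deficiency R U D -> X \subset U -> cand R Ks X ->
  size Ks <= 2 -> {in Ks, forall K, size K <= r} ->
  2 * (D + slack r) + b < #|X| ->
  b <= #|[set u in X | #|X :\: nextc R Ks X u| <= 2 * (D + slack r) + b]|.
Proof.
move=> hD XU hX sK sr szX; set L := 2 * (D + slack r) + b.
set A := [set _ in X | _].
have := lost_le hD XU XU hX hX sK sr; rewrite (big_setID A) /= => h.
have h2 : #|X :\: A| * L.+1 <= \sum_(u in X :\: A) #|X :\: nextc R Ks X u|.
  rewrite -sum_nat_const; apply: leq_sum => u; rewrite !inE.
  by case: (u \in X) => //=; rewrite ?andbF //= andbT -ltnNge.
have cA : #|A| + #|X :\: A| = #|X|.
  by rewrite -(cardsID A X) (setIidPr _) //; apply/subsetP => u; rewrite inE => /andP [].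
rewrite leqNgt; apply/negP => Ab.
have : #|X :\: A| * L.+1 <= 2 * #|X| * (D + slack r) by lia.
rewrite /L in szX *; move: (D + slack r) => E in szX *; nia.
Qed.

(** A branching form of having at least [b ^ k] sequences: it is what successive greedy choices
    produce, it composes under concatenation, and it allows averaging one entry at a time. *)
Fixpoint many (b k : nat) (phi : pred (seq T)) : bool :=
  if k is k'.+1 then b <= #|[set u | many b k' (fun s => phi (u :: s))]|
  else phi [::].

Lemma many_mono b k (phi psi : pred (seq T)) :
  (forall s, size s = k -> phi s -> psi s) -> many b k phi -> many b k psi.
Proof.
elim: k phi psi => [|k IH] phi psi h /=; first exact: h.
move=> hb; apply: (leq_trans hb); apply: subset_leq_card; apply/subsetP => u.
by rewrite !inE; apply: IH => s ss; apply: h; rewrite /= ss.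
Qed.

Lemma many_cat b j k phi :
  many b j (fun s => many b k (fun t => phi (s ++ t))) -> many b (j + k) phi.
Proof.
elim: j phi => [|j IH] phi //=.
move=> hb; apply: (leq_trans hb); apply: subset_leq_card; apply/subsetP => u.
by rewrite !inE => h; apply: IH.
Qed.

Lemma many_exists b k phi : 0 < b -> many b k phi -> exists2 s, size s = k & phi s.
Proof.
move=> b0; elim: k phi => [|k IH] phi /=; first by exists [::].
move=> hb; have /card_gt0P [u] := leq_trans b0 hb.
by rewrite inE => /IH [s ss hs]; exists (u :: s) => //=; rewrite ss.
Qed.

(** Only [k.-1] losses are paid, since nothing has to remain after the last pick. Each pick is
    consed onto every clique, hence [catrev]. *)
Lemma many_cliques (U X : {set T}) D Ks r b k :
  deficiency R U D -> X \subset U -> cand R Ks X -> 0 < b ->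
  size Ks <= 2 -> {in Ks, forall K, valid K /\ size K + k <= r} ->
  k.-1 * (2 * (D + slack r) + b) + b <= #|X| ->
  many b k (fun s => all (fun K => valid (catrev s K)) Ks && all (mem X) s).
Proof.
move=> hD; elim: k X Ks => [|k IH] X Ks XU hX b0 sK sr szX /=.
  by rewrite andbT; apply/allP => K /sr [].
have sr' : {in Ks, forall K, size K <= r}.
  by move=> K /sr [_]; apply: leq_trans; rewrite leq_addr.
have step u : u \in X ->
    k.-1 * (2 * (D + slack r) + b) + (if k is 0 then 0 else b) <= #|nextc R Ks X u| ->
    many b k (fun s => all (fun K => valid (catrev (u :: s) K)) Ks && all (mem X) (u :: s)).
  move=> uX sz.
  case: k IH sr szX sz => [|k] IH sr szX sz.
    rewrite /= uX !andbT; apply/allP => K KK; exact: (proj1 (hX u uX K KK)).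
  apply: (@many_mono _ _ (fun s => all (fun K => valid (catrev s K)) (map (cons u) Ks)
     && all (mem (nextc R Ks X u)) s)).
    move=> s _ /andP [/allP h1 /allP h2] /=; rewrite uX /=; apply/andP; split.
      by apply/allP => K KK; apply: (h1 (u :: K)); apply: map_f.
    by apply/allP => w /h2 /=; apply/subsetP/nextc_sub.
  apply: IH => //.
  - exact: (subset_trans (nextc_sub _ _ _)).
  - exact: nextc_cand.
  - by rewrite size_map.
  - move=> _ /mapP [K KK ->]; split; first exact: (proj1 (hX u uX K KK)).
    by have [_] := sr K KK; rewrite /= addSnnS.
case: (posnP k) => [k0|kpos].
  subst k; apply: (leq_trans szX); apply: subset_leq_card; apply/subsetP => u uX.
  by rewrite inE; apply: step.
have szX' : 2 * (D + slack r) + b < #|X|.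
  have := leq_pmull (2 * (D + slack r) + b) kpos; move: szX => /=; lia.
apply: (leq_trans (pick_many hD XU hX sK sr' szX')); apply: subset_leq_card.
apply/subsetP => u; rewrite !inE => /andP [uX hu]; apply: step => //.
have := nextc_card Ks X u; move: szX hu; case: (k) kpos => // k' _ /=.
by rewrite mulSn; lia.
Qed.

End Stars.
End Graph.

(** * Rainbow cliques with vertices in prescribed sets *)

Section Configurations.
Variables (T : finType) (C : eqType) (G : ecgraph T C).
Local Notation adj := (ecg_adj G).
Local Notation ecol := (ecol G).
Local Notation valid := (valid G).
Variables (R : T -> {set T}) (hR : rainbow_stars G R).
Variables (U : {set T}) (D : nat) (hD : deficiency R U D).

Lemma cand_star b (X : {set T}) : cand G R [:: [:: b]] (X :&: R b).
Proof.
move=> w; rewrite inE => /andP [_ wb] K; rewrite inE => /eqP ->; split.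
  by rewrite valid_consE /= ecg_sym (proj1 hR b).
by move=> v; rewrite inE => /eqP ->.
Qed.

Lemma card_star_ge b (X : {set T}) : b \in U -> X \subset U ->
  #|X| <= #|X :&: R b| + D.
Proof.
move=> bU XU; rewrite -(cardsID (R b) X) leq_add2l.
by apply: leq_trans (hD bU); apply: subset_leq_card; apply: setSD.
Qed.

(** Up to constants, restricting to [R b] costs [D] and each of [r - 2] further picks costs [2 * D];
    this is the source of the factor [2 * r - 3]. *)
Lemma clique_in_set b (X : {set T}) r : b \in U -> X \subset U -> 1 < r ->
  D + ((r - 2) * (2 * (D + slack r) + 1) + 1) <= #|X| ->
  exists s, [/\ size s = r.-1, {subset s <= X} & valid (catrev s [:: b])].
Proof.
move=> bU XU r1 szX.
have /many_exists[//|s ss /andP [vs sX]] : many 1 r.-1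
    (fun s => all (fun K => valid (catrev s K)) [:: [:: b]] && all (mem (X :&: R b)) s).
  apply: (many_cliques (r := r) hR hD) => //.
  - by apply: subset_trans XU; apply: subsetIl.
  - exact: cand_star.
  - by move=> K; rewrite inE => /eqP ->; split => //=; lia.
  - have := card_star_ge bU XU; move: szX.
    by rewrite (_ : r.-1.-1 = r - 2); lia.
exists s; split=> //; last by move: vs; rewrite /= andbT.
by move=> x /(allP sX); rewrite !inE => /andP [].
Qed.

(** The second vertex comes from [Y], the later ones from [X]. Averaging over [Y], its choice costs
    at most [(x + y) * (D + slack r) / y] of the [x] candidates; the size hypothesis is multiplied
    through by [y]. *)
Lemma clique_in_two_sets b (X Y : {set T}) r :
  b \in U -> X \subset U -> Y \subset U -> 2 < r ->
  let x := #|X :&: R b| in let y := #|Y :&: R b| in 0 < y ->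
  (x + y) * (D + slack r) + y * ((r - 3) * (2 * (D + slack r) + 1) + 1) <= y * x ->
  exists u s, [/\ u \in Y, size s = r - 2, {subset s <= X} &
    valid (catrev s [:: u; b])].
Proof.
move=> bU XU YU r2 x y y0 h.
have X'U : X :&: R b \subset U by apply: subset_trans XU; apply: subsetIl.
have Y'U : Y :&: R b \subset U by apply: subset_trans YU; apply: subsetIl.
have sK : {in [:: [:: b]], forall K : seq T, size K <= r}.
  by move=> K; rewrite inE => /eqP -> /=; lia.
have [//|u uY hu] := pick_exists hR hD X'U Y'U (@cand_star b X) (@cand_star b Y) _ sK y0.
have := nextc_card G R [:: [:: b]] (X :&: R b) u.
set Z := nextc G R _ _ _; rewrite -/x => cZ.
have szZ : (r - 3) * (2 * (D + slack r) + 1) + 1 <= #|Z|.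
  rewrite -(leq_pmul2l y0); rewrite -/x -/y -/Z in hu.
  have : y * x = y * #|Z| + y * #|X :&: R b :\: Z| by rewrite -cZ mulnDr.
  lia.
have /many_exists[//|s ss /andP [vs sX]] : many 1 (r - 2)
    (fun s => all (fun K => valid (catrev s K)) [:: [:: u; b]] && all (mem Z) s).
  apply: (many_cliques (r := r) hR hD) => //.
  - by apply: subset_trans X'U; apply: nextc_sub.
  - exact: (@nextc_cand _ _ _ _ _ _ u (@cand_star b X)).
  - move=> K; rewrite inE => /eqP ->; split => /=; last by lia.
    by have [] := cand_star uY (mem_head _ _).
  - by rewrite (_ : (r - 2).-1 = r - 3) //; lia.
exists u, s; split=> //.
- by move: uY; rewrite inE => /andP [].
- move=> z /(allP sX) /= /(subsetP (nextc_sub _ _ _ _ _)).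
  by rewrite inE => /andP [].
- by move: vs; rewrite /= andbT.
Qed.

(** There are at most [D] vertices [v] outside [R w], each with at most [D + 1] partners. For [v] in
    [R w] the partner [u] lies outside [R w], and it determines [v]; this adds [D]. *)
Lemma same_colour_pairs_le w : w \in U ->
  \sum_(v in U) #|[set u in U | (u != v) && (ecol w u == ecol w v)]| <= D ^ 2 + 2 * D.
Proof.
move=> wU; rewrite (big_setID (R w)) /=.
have h1 : \sum_(v in U :\: R w) #|[set u in U | (u != v) && (ecol w u == ecol w v)]|
    <= D * (D + 1).
  apply: (leq_trans (n := \sum_(v in U :\: R w) (D + 1))); last first.
    by rewrite sum_nat_const leq_mul2r hD ?orbT.
  apply: leq_sum => v _.
  apply: leq_trans (bad_col_le hR [:: ecol w v] hD wU (subxx U)).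
  apply: subset_leq_card; apply/subsetP => u; rewrite !inE.
  by move=> /and3P [-> _ ->]; rewrite orbT.
have h2 : \sum_(v in U :&: R w) #|[set u in U | (u != v) && (ecol w u == ecol w v)]|
    <= D.
  apply: leq_trans (hD wU); rewrite -[#|U :\: R w|]sum1_card.
  under eq_bigr do rewrite -sum1_card.
  rewrite (exchange_big_dep (fun u => u \in U :\: R w)) /=.
    apply: leq_sum => u _; rewrite sum1_card.
    apply: leq_trans (star_col_le hR w U [:: ecol w u]).
    apply: subset_leq_card; apply/subsetP => v; rewrite !inE unfold_in /= !inE.
    by move=> /andP [/andP [-> ->]] /and3P [_ _ /eqP ->] /=.
  move=> v u; rewrite !inE => /andP [vU vR] /and3P [uU ne /eqP e].
  rewrite uU andbT; apply: contra ne => uR; apply/eqP.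
  exact: (proj2 hR w).
by move: h1 h2; lia.
Qed.

(** Without such a triangle, for [v1] in [Y1] and [v2] in [Y2 :&: R v1] all but [2 * D + 2] vertices
    [w] of [X] see [v1] and [v2] in the same colour. Summed over the pairs, this contradicts
    [same_colour_pairs_le]. *)
Lemma triangle_in_three_sets (X Y1 Y2 : {set T}) :
  X \subset U -> Y1 \subset U -> Y2 \subset U ->
  #|X| * (D ^ 2 + 2 * D) < #|Y1| * ((#|Y2| - D) * (#|X| - (2 * D + 2))) ->
  exists v1 v2 w, [/\ v1 \in Y1, v2 \in Y2, w \in X & valid [:: w; v2; v1]].
Proof.
move=> XU Y1U Y2U h.
have [/existsP [v1 /existsP [v2 /existsP [w /and4P [? ? ? ?]]]]|nE] := boolP
  [exists v1, exists v2, exists w,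
     [&& v1 \in Y1, v2 \in Y2, w \in X & valid [:: w; v2; v1]]].
  by exists v1, v2, w.
pose inm v1 v2 := [set w in X | (v2 != v1) && (ecol w v2 == ecol w v1)].
have lb v1 v2 : v1 \in Y1 -> v2 \in Y2 :&: R v1 ->
    #|X| - (2 * D + 2) <= #|inm v1 v2|.
  move=> v1Y; rewrite inE => /andP [v2Y v2R].
  have ne : v2 != v1.
    by apply/eqP => e; have := proj1 hR v1 _ v2R; rewrite e ecg_irr.
  pose B1 := [set w in X | (w \notin R v1) || (ecol v1 w \in [:: ecol v1 v2])].
  pose B2 := [set w in X | (w \notin R v2) || (ecol v2 w \in [:: ecol v2 v1])].
  have b1 : #|B1| <= D + 1 by apply: (bad_col_le hR _ hD) => //; apply: (subsetP Y1U).
  have b2 : #|B2| <= D + 1 by apply: (bad_col_le hR _ hD) => //; apply: (subsetP Y2U).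
  have : #|X| <= #|inm v1 v2 :|: (B1 :|: B2)|.
    apply: subset_leq_card; apply/subsetP => w wX; rewrite !inE wX ne /=.
    case: (boolP (ecol w v2 == ecol w v1)) => //= c0.
    case: (boolP (w \in R v1)) => //= w1; case: (boolP (w \in R v2)) => //= w2; last by rewrite orbT.
    case: (boolP (ecol v1 w == _)) => //= c1; case: (boolP (ecol v2 w == _)) => //= c2.
    move/existsPn: nE => /(_ v1) /existsPn /(_ v2) /existsPn /(_ w).
    rewrite v1Y v2Y wX /= valid_consE /= !(ecg_sym _ w) (proj1 hR v1) // (proj1 hR v2) //=.
    rewrite ecg_sym (proj1 hR v1) //= !inE negb_or c0 /= !andbT.
    by rewrite (ecol_sym _ w v2) c2 /= (ecol_sym _ w v1) (ecol_sym _ v2 v1) c1.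
  have h1 : #|inm v1 v2 :|: (B1 :|: B2)| <= #|inm v1 v2| + #|B1 :|: B2|.
    exact: leq_card_setU.
  have h2 : #|B1 :|: B2| <= #|B1| + #|B2| by apply: leq_card_setU.
  by lia.
have ub : \sum_(v1 in Y1) \sum_(v2 in Y2 :&: R v1) #|inm v1 v2| <= #|X| * (D ^ 2 + 2 * D).
  apply: (leq_trans (n := \sum_(v1 in U) \sum_(v2 in U) #|inm v1 v2|)).
    rewrite [X in _ <= X](big_setID Y1) /= (setIidPr Y1U).
    apply: leq_trans (leq_addr _ _); apply: leq_sum => v1 _.
    have sY : Y2 :&: R v1 \subset U by apply: subset_trans Y2U; apply: subsetIl.
    by rewrite [X in _ <= X](big_setID (Y2 :&: R v1)) /= (setIidPr sY) leq_addr.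
  under eq_bigr => v1 _.
    under eq_bigr do rewrite -sum1_card.
    rewrite (exchange_big_dep (fun w => w \in X)) /=; last first.
      by move=> v2 w _; rewrite inE => /andP [].
    over.
  rewrite exchange_big /= -sum_nat_const; apply: leq_sum => w wX.
  apply: leq_trans (same_colour_pairs_le (subsetP XU w wX)).
  apply: leq_sum => v1 _; rewrite sum1_card; apply: subset_leq_card.
  by apply/subsetP => v2; rewrite !inE unfold_in /= inE wX /= => /and3P [-> -> ->].
move: h; rewrite ltnNge => /negP []; apply: leq_trans ub.
rewrite -sum_nat_const; apply: leq_sum => v1 v1Y.
apply: (leq_trans (n := \sum_(v2 in Y2 :&: R v1) (#|X| - (2 * D + 2)))).
  rewrite sum_nat_const leq_mul2r; apply/orP; right.
  by rewrite leq_subLR addnC card_star_ge // (subsetP Y1U).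
by apply: leq_sum => v2; apply: lb.
Qed.

End Configurations.

(** * Quantiles of a vertex weight *)

Section Quantiles.
Local Open Scope ring_scope.
Variables (F : realType) (T : finType) (U : {set T}) (y : T -> F).
Local Notation N := #|U|.

(** The vertices are sorted by weight: [q i] is the weight at position [i], counted from 0, and
    [X k] holds the first [k] vertices. Thus [q k] belongs to the first vertex outside [X k], and
    [b] is a lightest vertex. *)
Lemma quantiles : (0 < N)%N ->
  exists (q : nat -> F) (X : nat -> {set T}),
  [/\ forall k, (k <= N)%N -> X k \subset U /\ #|X k| = k,
      forall k u, (k < N)%N -> u \in X k -> y u <= q k,
      forall i j, (i <= j < N)%N -> q i <= q j,
      \sum_(u in U) y u = \sum_(0 <= i < N) q i &
      exists2 b, b \in U & y b = q 0%N].
Proof.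
move=> /card_gt0P [x0 x0U].
pose le := [rel u v | y u <= y v].
have tot : total le by move=> u v; apply: le_total.
have trans : transitive le by move=> a b c; apply: le_trans.
pose s := sort le (enum U).
have ps : perm_eq s (enum U) by rewrite perm_sort.
have us : uniq s by rewrite (perm_uniq ps) enum_uniq.
have sz : size s = N by rewrite (perm_size ps) -cardE.
have ms u : (u \in s) = (u \in U) by rewrite (perm_mem ps) mem_enum.
have ss : sorted le s by apply: sort_sorted.
have mono i j : (i <= j < N)%N -> y (nth x0 s i) <= y (nth x0 s j).
  move=> /andP [ij jN].
  by apply: (sorted_leq_nth trans _ x0 ss) => //; rewrite ?inE ?sz //; [move=> ? /=; apply: lexx | lia].
exists (fun i => y (nth x0 s i)), (fun k => [set u in take k s]); split=> //.
- move=> k kN; split.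
    by apply/subsetP => u; rewrite inE => /mem_take; rewrite ms.
  by rewrite cardsE (card_uniqP (take_uniq _ us)) size_takel // sz.
- move=> k u kN; rewrite inE => uk.
  have ik : (index u (take k s) < k)%N.
    by rewrite -[X in (_ < X)%N](@size_takel k _ s) ?index_mem // sz ltnW.
  have <- : nth x0 s (index u (take k s)) = u by rewrite -(nth_take _ ik) nth_index.
  by apply: mono; rewrite ltnW.
- transitivity (\sum_(u in s) y u); first by apply: eq_bigl => u; rewrite ms.
  by rewrite -big_uniq // (big_nth x0) sz.
- exists (nth x0 s 0) => //; rewrite -ms mem_nth // sz.
  by apply/card_gt0P; exists x0.
Qed.

(** For sorted [q] this is the total weight above the threshold [q k], that is, the sum of the
    positive parts of [q i - q k]. *)
Definition excess (q : nat -> F) (n k : nat) : F := \sum_(k <= i < n) (q i - q k).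

Lemma sum_excess (q : nat -> F) N :
  \sum_(0 <= i < N) q i = excess q N 0 + N%:R * q 0%N.
Proof. by rewrite /excess sumrB sumr_const_nat subn0 mulr_natl subrK. Qed.

Lemma excess_ge0 (q : nat -> F) n k :
  (forall i j, (i <= j < n)%N -> q i <= q j) -> 0 <= excess q n k.
Proof.
move=> mono; rewrite /excess big_nat_cond; apply: sumr_ge0 => i.
by rewrite andbT subr_ge0 => /andP [ki iN]; apply: mono; rewrite ki.
Qed.

(** Lowering the threshold from [qb] to [qa] adds at least [qb - qa] for each of the at least
    [(1 - b / m) n] positions from [n * b %/ m] on. *)
Lemma excess_step (q : nat -> F) n a b m :
  (forall i j, (i <= j < n)%N -> q i <= q j) -> (0 < n)%N ->
  (a <= b < m)%N ->
  let qa := q (n * a %/ m)%N in let qb := q (n * b %/ m)%N in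
  qa <= qb /\
  excess q n (n * b %/ m) + (1 - b%:R / m%:R) * (n%:R * qb - n%:R * qa)
    <= excess q n (n * a %/ m).
Proof.
move=> mono n0 /andP [ab bm] qa qb; rewrite /qa /qb.
set i := (n * a %/ m)%N; set j := (n * b %/ m)%N.
have m0 : (0 < m)%N by lia.
have ij : (i <= j)%N by apply: leq_div2r; rewrite leq_mul2l ab orbT.
have jn : (j < n)%N by rewrite ltn_divLR // ltn_mul2l n0.
have qij : q i <= q j by apply: mono; rewrite ij.
split=> //; rewrite /excess (big_cat_nat ij (ltnW jn)) /=.
have h1 : 0 <= \sum_(i <= k < j) (q k - q i).
  rewrite big_nat_cond; apply: sumr_ge0 => k; rewrite andbT subr_ge0 => /andP [ik kj].
  by apply: mono; rewrite ik /=; lia.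
have -> : \sum_(j <= k < n) (q k - q i) =
    \sum_(j <= k < n) (q k - q j) + (n - j)%:R * (q j - q i).
  rewrite mulr_natl -(sumr_const_nat n j) -big_split /=.
  by apply: eq_bigr => k _; ring.
have h2 : (1 - b%:R / m%:R) * n%:R <= (n - j)%:R :> F.
  rewrite natrB ?(ltnW jn) // mulrBl mul1r lerB //.
  rewrite mulrAC ler_pdivlMr ?ltr0n // -!natrM ler_nat mulnC [X in (_ <= X)%N]mulnC.
  by rewrite mulnC; apply: leq_trunc_div.
rewrite -mulrBr mulrA.
have : (1 - b%:R / m%:R) * n%:R * (q j - q i) <= (n - j)%:R * (q j - q i).
  by apply: ler_wpM2r => //; rewrite subr_ge0.
lra.
Qed.

End Quantiles.

(** * Rainbow cliques of at most average weight *)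

Section Balanced.
Local Open Scope ring_scope.

(** The weights may be negative and [N0] does not depend on them, because they will be gradients of
    a potential that changes with every removed clique. *)
Definition balancing (F : realType) (r : nat) (g : F) : Prop :=
  exists N0 : nat, forall (T : finType) (C : eqType) (G : ecgraph T C)
    (R : T -> {set T}) (U : {set T}), rainbow_stars G R -> (N0 <= #|U|)%N ->
    {in U, forall v, #|U :\: R v|%:R <= g * #|U|%:R} ->
    forall y : T -> F, exists K : seq T,
      [/\ valid G K, size K = r, {subset K <= U} &
          #|U|%:R * \sum_(u <- K) y u <= r%:R * \sum_(u in U) y u].

Lemma deficiency_floor (F : realType) (g : F) (m E : nat) : (0 < m)%N -> g < m%:R^-1 ->
  exists N0 : nat, forall N d : nat, (N0 <= N)%N -> d%:R <= g * N%:R ->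
    (d + E <= N %/ m)%N.
Proof.
move=> m0 gm.
have e0 : 0 < m%:R^-1 - g by rewrite subr_gt0.
pose N0 := (Num.truncn ((E + 1)%:R / (m%:R^-1 - g))).+1.
exists N0 => N d hN hd.
have hN' : (E + 1)%:R <= (m%:R^-1 - g) * N%:R.
  rewrite mulrC -ler_pdivrMr //; apply: ltW; apply: (lt_le_trans (truncnS_gt _)).
  by rewrite ler_nat.
have m0' : 0 < m%:R :> F by rewrite ltr0n.
rewrite leq_divRL // -(ler_nat F) natrM -ler_pdivlMr // natrD.
move: hN'; rewrite natrD mulrBl mulrC; lra.
Qed.

(** With [q1] the quantile at [1 / r], the excess over [q0] is at least [(1 - 1 / r) N (q1 - q0)];
    multiplied by [r] it pays for [r.-1] vertices of weight [q1]. *)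
Lemma single_set_balance (F : realType) (r N : nat) (S q0 q1 e0 e1 : F) :
  (0 < r)%N -> S <= q0 + (r.-1)%:R * q1 ->
  e1 + (1 - 1%:R / r%:R) * (N%:R * q1 - N%:R * q0) <= e0 -> 0 <= e1 ->
  N%:R * S <= r%:R * (e0 + N%:R * q0).
Proof.
case: r => // r _; rewrite succnK => hS he e1_ge0.
have hN := ler_wpM2l (ler0n F N) hS.
have r1_gt0 : 0 < r.+1%:R :> F by rewrite ltr0n.
have he' : (1 - 1%:R / r.+1%:R) * (N%:R * q1 - N%:R * q0) <= e0.
  by apply: le_trans he; rewrite lerDr.
have := ler_wpM2l (ltW r1_gt0) he'.
have rE : r.+1%:R * (1 - 1%:R / r.+1%:R) = r%:R :> F.
  by rewrite mulrBr mulr1 mulrCA divff ?gt_eqF // mulr1 -natr1 addrK.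
rewrite mulrA rE => h; apply: (le_trans hN); rewrite (mulrDr r.+1%:R).
have -> : N%:R * (q0 + r%:R * q1) =
    r%:R * (N%:R * q1 - N%:R * q0) + r.+1%:R * (N%:R * q0).
  by rewrite -natr1; ring.
by rewrite lerD2r.
Qed.

(** A lightest vertex is completed inside the lightest [N / r] vertices. By [clique_in_set] this
    needs roughly [(2 * r - 3) * D <= N / r], which is the threshold. *)
Lemma balancing_general (F : realType) r (g : F) : (1 < r)%N ->
  g < ((2 * r - 3) * r)%:R^-1 -> balancing r g.
Proof.
move=> r1 hg.
pose E := ((r - 2) * (2 * slack r + 1) + 1)%N.
have m0 : (0 < (2 * r - 3) * r)%N by rewrite muln_gt0; lia.
have [N0 hN0] := deficiency_floor E m0 hg.
exists (N0 + r)%N => T C G R U hR hN hd y.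
have U0 : (0 < #|U|)%N by lia.
have [q [X [hX hXq mono -> [b bU yb]]]] := quantiles y U0.
set N := #|U| in hN hd hX hXq mono U0 *.
(* Subtracting [E] reserves room for [slack], so that the linear bound holds exactly for [D + E]. *)
set D := (N %/ ((2 * r - 3) * r) - E)%N.
have hDE v : v \in U -> (#|U :\: R v| + E <= N %/ ((2 * r - 3) * r))%N.
  by move=> vU; apply: hN0; [lia | apply: hd].
have hD : deficiency R U D by move=> v vU; have := hDE v vU; rewrite /D; lia.
have EN := hDE b bU.
pose k := (N * 1 %/ r)%N.
have kN : (k < N)%N by rewrite /k muln1 ltn_Pdiv.
have [XU szX] := hX k (ltnW kN).
have hsz : (D + ((r - 2) * (2 * (D + slack r) + 1) + 1) <= #|X k|)%N.
  rewrite szX /k muln1.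
  have h : ((2 * r - 3) * (N %/ ((2 * r - 3) * r)) <= N %/ r)%N.
    rewrite leq_divRL; last lia.
    by rewrite -mulnA [X in (_ * X)%N]mulnC mulnA mulnC; have := leq_trunc_div N ((2 * r - 3) * r); nia.
  have h2 : ((2 * r - 3) * (D + E) <= N %/ r)%N by rewrite /D subnK //; lia.
  apply: leq_trans h2.
  have -> : (D + ((r - 2) * (2 * (D + slack r) + 1) + 1) = (2 * r - 3) * D + E)%N.
    by rewrite (_ : (2 * r - 3 = 1 + 2 * (r - 2))%N) /E; [ring | lia].
  by rewrite mulnDr leq_add2l leq_pmull //; lia.
have [s [ss sX vs]] := clique_in_set hR hD bU XU r1 hsz.
have sU : {subset s <= U} by move=> z /sX; apply: (subsetP XU).
exists (catrev s [:: b]); split=> //.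
- by rewrite catrevE size_cat size_rev ss /=; lia.
- by move=> z; rewrite catrevE mem_cat mem_rev inE => /orP [/sU//|/eqP ->].
have hsum : \sum_(u <- catrev s [:: b]) y u <= q 0%N + (r.-1)%:R * q k.
  rewrite catrevE big_cat /= big_seq1 yb addrC lerD2l (perm_big s) ?perm_rev //=.
  have -> : (r.-1)%:R * q k = \sum_(u <- s) q k.
    by rewrite big_const_seq count_predT iter_addr_0 ss mulr_natl.
  rewrite big_seq [leRHS]big_seq.
  by apply: ler_sum => u us; apply: hXq => //; apply: sX.
have [h0 h1] := @excess_step F q N 0 1 r mono U0 r1.
rewrite muln0 div0n -/k in h1.
have h2 := excess_ge0 k mono.
rewrite sum_excess.
exact: (single_set_balance (ltnW r1) hsum h1 h2).
Qed.

(** The claim amounts to [d ^ 2 + y <= (x - d) * (y - d)]. In units of [N / 18] the main terms on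
    the right are 10 times 1 and 5 times 2, against 3 times 3 on the left. *)
Lemma two_set_arith3 (N d x y a b : nat) : (600 <= N)%N -> (6 * d <= N)%N ->
  (a * N <= 18 * (x + d + 1))%N -> (b * N <= 18 * (y + d + 1))%N -> (y <= N)%N ->
  (a, b) \in [:: (16, 7); (11, 8)] ->
  ((x + y) * d + y * (0 * (2 * d + 1) + 1) <= y * x)%N.
Proof.
move=> hN hd hx hy yN ab.
have [P xE] : exists P, x = (d + P)%N.
  by exists (x - d)%N; move: ab; rewrite !inE => /orP [/eqP [? ?]|/eqP [? ?]]; subst; lia.
have [Q yE] : exists Q, y = (d + Q)%N.
  by exists (y - d)%N; move: ab; rewrite !inE => /orP [/eqP [? ?]|/eqP [? ?]]; subst; lia.
subst x y; suff : (d ^ 2 + (d + Q) <= P * Q)%N by nia.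
have d2 : (36 * d ^ 2 <= N ^ 2)%N by nia.
move: ab; rewrite !inE => /orP [/eqP [? ?]|/eqP [? ?]]; subst a b.
- have hP : (10 * N <= 18 * P + 18)%N by lia.
  have hQ : (N <= 18 * Q + 18)%N by lia.
  have : ((10 * N - 18) * (N - 18) <= 18 * P * (18 * Q))%N by apply: leq_mul; lia.
  nia.
- have hP : (5 * N <= 18 * P + 18)%N by lia.
  have hQ : (2 * N <= 18 * Q + 18)%N by lia.
  have : ((5 * N - 18) * (2 * N - 18) <= 18 * P * (18 * Q))%N by apply: leq_mul; lia.
  nia.
Qed.

(** In units of [N / 18] the main terms are 16 times 3 times 3, which is 144, against 5 times 3
    times 10, which is 150. *)
Lemma three_set_arith3 (N d x y z : nat) : (5000 <= N)%N -> (6 * d <= N)%N ->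
  (16 * N <= 18 * (x + 1))%N -> (18 * x <= 16 * N)%N ->
  (5 * N <= 18 * (y + 1))%N -> (6 * N <= 18 * (z + 1))%N ->
  (x * (d ^ 2 + 2 * d) < y * ((z - d) * (x - (2 * d + 2))))%N.
Proof.
move=> hN hd hx hx' hy hz.
(* The shares 5/18, 3/18 and 10/18 are 500, 300 and 1000 over 1800; lowering each numerator by 2,
   and raising 100 to 101 in [l4], covers the lower-order terms. *)
have l1 : (498 * N <= 1800 * y)%N by lia.
have l2 : (298 * N <= 1800 * (z - d))%N by lia.
have l3 : (998 * N <= 1800 * (x - (2 * d + 2)))%N by lia.
have l4 : (3600 * (d ^ 2 + 2 * d) <= 101 * N ^ 2)%N by nia.
have := leq_mul hx' l4; have := leq_mul l1 (leq_mul l2 l3).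
set u := (z - d)%N; set v := (x - _)%N; set w := (d ^ 2 + 2 * d)%N.
rewrite !expnS !expn0 => h1 h2.
have N3 : (0 < N * N * N)%N by rewrite !muln_gt0; lia.
have e1 : (498 * N * (298 * N * (998 * N)) = 498 * 298 * 998 * (N * N * N))%N by ring.
have e2 : (1800 * y * (1800 * u * (1800 * v)) = 1800 * 1800 * 1800 * (y * (u * v)))%N by ring.
have e3 : (16 * N * (101 * (N * (N * 1))) = 16 * 101 * (N * N * N))%N by ring.
have e4 : (18 * x * (3600 * w) = 18 * 3600 * (x * w))%N by ring.
rewrite e1 e2 in h1; rewrite e3 e4 in h2.
move: (N * N * N)%N (x * w)%N (y * (u * v))%N N3 h1 h2 => {e1 e2 e3 e4}.
move=> n3 A B; lia.
Qed.

(** With [x = 3 * d + P] and [y = d + Q] the claim follows from [3 * d ^ 2 + 2 * y <= P * Q]. In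
    units of [N / 88] the main terms are 192 on the left and 34 times 6 or 12 times 17, both 204, on
    the right. *)
Lemma two_set_arith4 (N d x y a b : nat) : (3000 <= N)%N -> (11 * d <= N)%N ->
  (a * N <= 8 * (x + d + 1))%N -> (b * N <= 8 * (y + d + 1))%N -> (y <= N)%N ->
  (a, b) \in [:: (6, 2); (4, 3)] ->
  ((x + y) * d + y * (1 * (2 * d + 1) + 1) <= y * x)%N.
Proof.
move=> hN hd hx hy yN ab.
have [P xE] : exists P, x = (3 * d + P)%N.
  by exists (x - 3 * d)%N; move: ab; rewrite !inE => /orP [/eqP [? ?]|/eqP [? ?]]; subst; lia.
have [Q yE] : exists Q, y = (d + Q)%N.
  by exists (y - d)%N; move: ab; rewrite !inE => /orP [/eqP [? ?]|/eqP [? ?]]; subst; lia.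
subst x y; suff : (3 * d ^ 2 + 2 * (d + Q) <= P * Q)%N by nia.
have d2 : (121 * d ^ 2 <= N ^ 2)%N by nia.
move: ab; rewrite !inE => /orP [/eqP [? ?]|/eqP [? ?]]; subst a b.
- have hP : (34 * N <= 88 * P + 88)%N by lia.
  have hQ : (6 * N <= 88 * Q + 88)%N by lia.
  have : ((34 * N - 88) * (6 * N - 88) <= 88 * P * (88 * Q))%N by apply: leq_mul; lia.
  nia.
- have hP : (12 * N <= 88 * P + 88)%N by lia.
  have hQ : (17 * N <= 88 * Q + 88)%N by lia.
  have : ((12 * N - 88) * (17 * N - 88) <= 88 * P * (88 * Q))%N by apply: leq_mul; lia.
  nia.
Qed.


(** Here [ej] is the excess and [zj] is [N] times the quantile at [j / 18]. The combination
    [A1 / 6 + 2 * A2 / 3 + A3 / 6] is at most [3 * (e0 + z0)], so the three values cannot all exceed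
    it. *)
Lemma certificate3 (F : realType) (e0 e5 e6 e7 e8 e11 e16 z0 z5 z6 z7 z8 z11 z16 : F)
    (A1 A2 A3 : F) :
  e5 + (1 - 5%:R / 18%:R) * (z5 - z0) <= e0 -> e6 + (1 - 6%:R / 18%:R) * (z6 - z5) <= e5 ->
  e7 + (1 - 7%:R / 18%:R) * (z7 - z6) <= e6 -> e8 + (1 - 8%:R / 18%:R) * (z8 - z7) <= e7 ->
  e11 + (1 - 11%:R / 18%:R) * (z11 - z8) <= e8 ->
  e16 + (1 - 16%:R / 18%:R) * (z16 - z11) <= e11 -> 0 <= e16 ->
  z8 <= z11 -> z11 <= z16 ->
  A1 <= z0 + z7 + z16 -> A2 <= z0 + z8 + z11 -> A3 <= z5 + z6 + z16 ->
  3%:R * (e0 + z0) < A1 -> 3%:R * (e0 + z0) < A2 -> A3 <= 3%:R * (e0 + z0).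
Proof. by lra. Qed.

(* The clique is found inside one of three families of lowest-weight prefixes,
   of relative sizes (0, 7, 16)/18, (0, 8, 11)/18 and (5, 6, 16)/18. Choosing
   among them with probabilities 1/6, 2/3 and 1/6 the expected number of
   vertices above any quantile t is at most 3 (1 - t), so one of them has at
   most average weight. *)
Lemma balancing_3 (F : realType) (g : F) : g < 6%:R^-1 -> balancing 3 g.
Proof.
move=> hg.
have [N0 hN0] := deficiency_floor (slack 3) (isT : (0 < 6)%N) hg.
exists (N0 + 5000)%N => T C G R U hR hN hd y.
have U0 : (0 < #|U|)%N by lia.
have [q [X [hX hXq mono -> [b bU yb]]]] := quantiles y U0.
have hDE v : v \in U -> (#|U :\: R v| + slack 3 <= #|U| %/ 6)%N.
  by move=> vU; apply: hN0; [lia | apply: hd].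
move: #|U| hN hX hXq mono U0 hDE {hd} => N hN hX hXq mono U0 hDE.
set D := (N %/ 6 - slack 3)%N.
have hD : deficiency R U D by move=> v vU; have := hDE v vU; rewrite /D; lia.
have DE : (D + slack 3 = N %/ 6)%N by rewrite /D subnK //; have := hDE b bU; lia.
have d6 : (6 * (N %/ 6) <= N)%N by rewrite mulnC leq_trunc_div.
have hN' : (5000 <= N)%N by lia.
pose k j := (N * j %/ 18)%N.
have kN j : (j < 18)%N -> (k j < N)%N by move=> j18; rewrite ltn_divLR // ltn_mul2l U0.
have kle j : (18 * k j <= j * N)%N by rewrite mulnC [X in (_ <= X)%N]mulnC leq_trunc_div.
have kge j : (j * N <= 18 * (k j + 1))%N.
  by rewrite mulnC addn1 [X in (_ <= X)%N]mulnC ltnW // ltn_ceil.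
have XU j : (j < 18)%N -> X (k j) \subset U by move=> /kN /ltnW /hX [].
have Xc j : (j < 18)%N -> #|X (k j)| = k j by move=> /kN /ltnW /hX [].
have two j1 j2 : (j2, j1) \in [:: (16, 7); (11, 8)] ->
    exists K, [/\ valid G K, size K = 3%N, {subset K <= U} &
      \sum_(u <- K) y u <= q 0%N + q (k j1) + q (k j2)].
  move=> hj.
  have [j1s j2s] : (j1 < 18 /\ j2 < 18)%N.
    by move: hj; rewrite !inE => /orP [/eqP [-> ->]|/eqP [-> ->]].
  have hx := card_star_ge hD bU (XU j2 j2s); have hy := card_star_ge hD bU (XU j1 j1s).
  rewrite Xc // in hx; rewrite Xc // in hy.
  have hyN : (#|X (k j1) :&: R b| <= N)%N.
    apply: (@leq_trans #|X (k j1)|); first by apply/subset_leq_card/subsetIl.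
    by rewrite Xc // ltnW // kN.
  have k1 := kge j1; have k2 := kge j2.
  have y0 : (0 < #|X (k j1) :&: R b|)%N.
    by move: hj; rewrite !inE => /orP [/eqP [? ?]|/eqP [? ?]]; subst; lia.
  have [|u [s [uY ss sX vs]]] := clique_in_two_sets hR hD bU (XU j2 j2s) (XU j1 j1s)
    (isT : (2 < 3)%N) y0.
    rewrite DE; apply: (two_set_arith3 _ d6 _ _ hyN hj); lia.
  case: s ss sX vs => [|w [|]] //= _ sX vs.
  have wX : w \in X (k j2) by apply: sX; rewrite mem_head.
  exists [:: w; u; b]; split=> //.
    move=> z; rewrite !inE => /or3P [] /eqP -> //.
      exact: (subsetP (XU _ j2s)).
    exact: (subsetP (XU _ j1s)).
  rewrite !big_cons big_nil yb.
  have := hXq _ _ (kN _ j2s) wX; have := hXq _ _ (kN _ j1s) uY; lra.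
have [K1 [v1 s1 u1 h1]] := two 7%N 16%N isT.
have [K2 [v2 s2 u2 h2]] := two 8%N 11%N isT.
have [|a1 [a2 [w [Y1 Y2 wX va]]]] := triangle_in_three_sets hR hD
   (XU 16%N isT) (XU 5%N isT) (XU 6%N isT).
  rewrite !Xc //; apply: (three_set_arith3 hN') => //; lia.
have h3 : \sum_(u <- [:: w; a2; a1]) y u <= q (k 5%N) + q (k 6%N) + q (k 16%N).
  rewrite !big_cons big_nil.
  have := hXq _ _ (kN 16%N isT) wX; have := hXq _ _ (kN 6%N isT) Y2.
  have := hXq _ _ (kN 5%N isT) Y1; lra.
have u3 : {subset [:: w; a2; a1] <= U}.
  move=> z; rewrite !inE => /or3P [] /eqP ->; [move: wX | move: Y2 | move: Y1];
  by apply/subsetP/XU.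
have sum3 := sum_excess q N.
have [m1 e1] := @excess_step F q N 0 5 18 mono U0 isT.
have [m2 e2] := @excess_step F q N 5 6 18 mono U0 isT.
have [m3 e3] := @excess_step F q N 6 7 18 mono U0 isT.
have [m4 e4] := @excess_step F q N 7 8 18 mono U0 isT.
have [m5 e5] := @excess_step F q N 8 11 18 mono U0 isT.
have [m6 e6] := @excess_step F q N 11 16 18 mono U0 isT.
have e7 := @excess_ge0 F q N (k 16%N) mono.
rewrite muln0 div0n -!/(k _) in m1 e1 m2 e2 m3 e3 m4 e4 m5 e5 m6 e6.
have N0' : 0 <= N%:R :> F by rewrite ler0n.
have M1 := ler_wpM2l N0' h1; have M2 := ler_wpM2l N0' h2; have M3 := ler_wpM2l N0' h3.
have L5 := ler_wpM2l N0' m5; have L6 := ler_wpM2l N0' m6.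
rewrite !mulrDr in M1 M2 M3.
case: (leP (N%:R * \sum_(u <- K1) y u) (3%:R * \sum_(0 <= i < N) q i)) => c1.
  by exists K1.
case: (leP (N%:R * \sum_(u <- K2) y u) (3%:R * \sum_(0 <= i < N) q i)) => c2.
  by exists K2.
exists [:: w; a2; a1]; split=> //.
rewrite sum3 in c1 c2 *.
exact: (certificate3 e1 e2 e3 e4 e5 e6 e7 L5 L6 M1 M2 M3 c1 c2).
Qed.

(** As in [certificate3], in eighths: the mean of [A1] and [A2] is at most [4 * (e0 + z0)]. *)
Lemma certificate4 (F : realType) (e0 e2 e3 e4 e6 z0 z2 z3 z4 z6 A1 A2 : F) :
  e2 + (1 - 2%:R / 8%:R) * (z2 - z0) <= e0 -> e3 + (1 - 3%:R / 8%:R) * (z3 - z2) <= e2 ->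
  e4 + (1 - 4%:R / 8%:R) * (z4 - z3) <= e3 -> e6 + (1 - 6%:R / 8%:R) * (z6 - z4) <= e4 ->
  0 <= e6 -> A1 <= z0 + z2 + z6 + z6 -> A2 <= z0 + z3 + z4 + z4 ->
  4%:R * (e0 + z0) < A1 -> A2 <= 4%:R * (e0 + z0).
Proof. by lra. Qed.

(* Prefixes of relative sizes (0, 2, 6, 6)/8 and (0, 3, 4, 4)/8, with equal
   probabilities. *)
Lemma balancing_4 (F : realType) (g : F) : g < 11%:R^-1 -> balancing 4 g.
Proof.
move=> hg.
have [N0 hN0] := deficiency_floor (slack 4) (isT : (0 < 11)%N) hg.
exists (N0 + 3000)%N => T C G R U hR hN hd y.
have U0 : (0 < #|U|)%N by lia.
have [q [X [hX hXq mono -> [b bU yb]]]] := quantiles y U0.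
have hDE v : v \in U -> (#|U :\: R v| + slack 4 <= #|U| %/ 11)%N.
  by move=> vU; apply: hN0; [lia | apply: hd].
move: #|U| hN hX hXq mono U0 hDE {hd} => N hN hX hXq mono U0 hDE.
set D := (N %/ 11 - slack 4)%N.
have hD : deficiency R U D by move=> v vU; have := hDE v vU; rewrite /D; lia.
have DE : (D + slack 4 = N %/ 11)%N by rewrite /D subnK //; have := hDE b bU; lia.
have d6 : (11 * (N %/ 11) <= N)%N by rewrite mulnC leq_trunc_div.
have hN' : (3000 <= N)%N by lia.
pose k j := (N * j %/ 8)%N.
have kN j : (j < 8)%N -> (k j < N)%N by move=> j8; rewrite ltn_divLR // ltn_mul2l U0.
have kge j : (j * N <= 8 * (k j + 1))%N.
  by rewrite mulnC addn1 [X in (_ <= X)%N]mulnC ltnW // ltn_ceil.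
have XU j : (j < 8)%N -> X (k j) \subset U by move=> /kN /ltnW /hX [].
have Xc j : (j < 8)%N -> #|X (k j)| = k j by move=> /kN /ltnW /hX [].
have two j1 j2 : (j2, j1) \in [:: (6, 2); (4, 3)] ->
    exists K, [/\ valid G K, size K = 4%N, {subset K <= U} &
      \sum_(u <- K) y u <= q 0%N + q (k j1) + q (k j2) + q (k j2)].
  move=> hj.
  have [j1s j2s] : (j1 < 8 /\ j2 < 8)%N.
    by move: hj; rewrite !inE => /orP [/eqP [-> ->]|/eqP [-> ->]].
  have hx := card_star_ge hD bU (XU j2 j2s); have hy := card_star_ge hD bU (XU j1 j1s).
  rewrite Xc // in hx; rewrite Xc // in hy.
  have hyN : (#|X (k j1) :&: R b| <= N)%N.
    apply: (@leq_trans #|X (k j1)|); first by apply/subset_leq_card/subsetIl.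
    by rewrite Xc // ltnW // kN.
  have k1 := kge j1; have k2 := kge j2.
  have y0 : (0 < #|X (k j1) :&: R b|)%N.
    by move: hj; rewrite !inE => /orP [/eqP [? ?]|/eqP [? ?]]; subst; lia.
  have [|u [s [uY ss sX vs]]] := clique_in_two_sets hR hD bU (XU j2 j2s) (XU j1 j1s)
    (isT : (2 < 4)%N) y0.
    rewrite DE; apply: (two_set_arith4 _ d6 _ _ hyN hj); lia.
  case: s ss sX vs => [|w1 [|w2 [|]]] //= _ sX vs.
  have w1X : w1 \in X (k j2) by apply: sX; rewrite !inE eqxx.
  have w2X : w2 \in X (k j2) by apply: sX; rewrite !inE eqxx orbT.
  exists [:: w2; w1; u; b]; split=> //.
    move=> z; rewrite !inE => /or4P [] /eqP -> //;
      [exact: (subsetP (XU _ j2s)) | exact: (subsetP (XU _ j2s)) |].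
    exact: (subsetP (XU _ j1s)).
  rewrite !big_cons big_nil yb.
  have := hXq _ _ (kN _ j2s) w1X; have := hXq _ _ (kN _ j2s) w2X.
  have := hXq _ _ (kN _ j1s) uY; lra.
have [K1 [v1 s1 u1 h1]] := two 2%N 6%N isT.
have [K2 [v2 s2 u2 h2]] := two 3%N 4%N isT.
have [m1 e1] := @excess_step F q N 0 2 8 mono U0 isT.
have [m2 e2] := @excess_step F q N 2 3 8 mono U0 isT.
have [m3 e3] := @excess_step F q N 3 4 8 mono U0 isT.
have [m4 e4] := @excess_step F q N 4 6 8 mono U0 isT.
have e5 := @excess_ge0 F q N (k 6%N) mono.
rewrite muln0 div0n -!/(k _) in m1 e1 m2 e2 m3 e3 m4 e4.
have N0' : 0 <= N%:R :> F by rewrite ler0n.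
have M1 := ler_wpM2l N0' h1; have M2 := ler_wpM2l N0' h2.
rewrite !mulrDr in M1 M2.
case: (leP (N%:R * \sum_(u <- K1) y u) (4%:R * \sum_(0 <= i < N) q i)) => c1.
  by exists K1.
exists K2; split=> //; rewrite sum_excess in c1 *.
exact: (certificate4 e1 e2 e3 e4 e5 M1 M2 c1).
Qed.

End Balanced.

(** * Sets that split into rainbow cliques *)

Section Tileable.
Variables (T : finType) (C : eqType) (G : ecgraph T C) (r : nat).

(** Tiles and tileability are booleans, with cliques as tuples to keep the quantifier finite, so
    that absorbers can later be counted with [count]. *)
Definition tile (A : {set T}) : bool :=
  [exists K : r.-tuple T, valid G K && (A == [set x in K])].

Definition tileable (X : {set T}) : bool :=
  [exists P : {set {set T}},
    [&& trivIset P, [forall A in P, tile A] & cover P == X]].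

Lemma tileable0 : tileable set0.
Proof.
apply/existsP; exists set0; rewrite /cover big_set0 eqxx andbT.
by apply/andP; split; [apply/trivIsetP | apply/forall_inP] => A; rewrite inE.
Qed.

Lemma tileableU (X Y : {set T}) :
  [disjoint X & Y] -> tileable X -> tileable Y -> tileable (X :|: Y).
Proof.
move=> dXY /existsP [P /and3P [tP /forall_inP aP /eqP cP]].
move=> /existsP [Q /and3P [tQ /forall_inP aQ /eqP cQ]].
apply/existsP; exists (P :|: Q); apply/and3P; split.
- by apply: trivIsetU => //; rewrite cP cQ.
- by apply/forall_inP => A; rewrite inE => /orP [/aP|/aQ].
- by rewrite /cover bigcup_setU -!/(cover _) cP cQ.
Qed.

Lemma tileable_clique K : valid G K -> size K = r -> tileable [set x in K].
Proof.
move=> vK sK; apply/existsP; exists [set [set x in K]]; apply/and3P; split.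
- by apply/trivIsetP => A B; rewrite !inE => /eqP -> /eqP ->; rewrite eqxx.
- apply/forall_inP => A; rewrite inE => /eqP ->; apply/existsP.
  have sK' : size K == r by apply/eqP.
  by exists (Tuple sK'); rewrite vK eqxx.
- by rewrite /cover big_set1.
Qed.

Lemma tile_rainbow A : tile A -> rainbow_Kr G r A.
Proof.
move=> /existsP [K /andP [vK /eqP ->]].
by have := valid_rainbow_Kr vK; rewrite size_tuple.
Qed.

Lemma tileable_dvd (X : {set T}) : tileable X -> r %| #|X|.
Proof.
move=> /existsP [P /and3P [/eqP tP /forall_inP aP /eqP <-]].
rewrite -tP; apply: dvdn_sum => A /aP /tile_rainbow [-> _ _]; exact: dvdnn.
Qed.

Lemma tileable_perfect : tileable [set: T] ->
  exists P : {set {set T}}, perfect_rainbow_Kr_tiling G r P.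
Proof.
move=> /existsP [P /and3P [tP /forall_inP aP /eqP cP]].
by exists P; split=> //; split=> // A /aP /tile_rainbow.
Qed.

End Tileable.

(** * Almost perfect tilings by removing balanced cliques *)

Section NearPerfect.
Local Open Scope ring_scope.

(** First [x ^+ 2] is replaced by [h] inside the square. Expanding then leaves the linear term in
    [x] and [4 d^2 (x^2 - h) + 4 h^2 (1 - 3 s)], which is not positive. *)
Lemma potential_pointwise (F : realType) (d x h s : F) :
  0 <= h -> x ^+ 2 <= h -> 1 <= s ->
  ((d + x) ^+ 2 + 3 * h * (s - 1)) ^+ 2 <=
  (d ^+ 2 + 3 * h * s) ^+ 2 + 4 * ((d ^+ 2 + 3 * h * s - 2 * h) * d) * x.
Proof.
move=> h0 xh s1.
set X := d ^+ 2 + 3 * h * s - 2 * h + 2 * d * x.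
have E0 : 0 <= (d + x) ^+ 2 + 3 * h * (s - 1).
  by rewrite addr_ge0 ?sqr_ge0 // !mulr_ge0 ?subr_ge0.
have EX : (d + x) ^+ 2 + 3 * h * (s - 1) <= X.
  have -> : (d + x) ^+ 2 + 3 * h * (s - 1) = X + (x ^+ 2 - h) by rewrite /X; ring.
  by rewrite gerDl subr_le0.
apply: (@le_trans _ _ (X ^+ 2)); first by rewrite lerXn2r ?nnegrE // (le_trans E0).
have -> : X ^+ 2 = (d ^+ 2 + 3 * h * s) ^+ 2 + 4 * ((d ^+ 2 + 3 * h * s - 2 * h) * d) * x
   + (4 * d ^+ 2 * (x ^+ 2 - h) + 4 * h ^+ 2 * (1 - 3 * s)) by rewrite /X; ring.
rewrite gerDl; have h1 : 0 <= 4 * d ^+ 2 * (h - x ^+ 2).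
  by apply: mulr_ge0; rewrite ?subr_ge0 // mulr_ge0 ?sqr_ge0.
have h2 : 0 <= 4 * h ^+ 2 * (3 * s - 1).
  apply: mulr_ge0; last by lra.
  by rewrite mulr_ge0 ?sqr_ge0.
have -> : 4 * d ^+ 2 * (x ^+ 2 - h) + 4 * h ^+ 2 * (1 - 3 * s) =
  - (4 * d ^+ 2 * (h - x ^+ 2) + 4 * h ^+ 2 * (3 * s - 1)) by ring.
by rewrite oppr_le0 addr_ge0.
Qed.

Section Step.
Variables (F : realType) (T : finType) (R : T -> {set T}) (U : {set T}).

Definition missing (V : {set T}) v : F := \sum_(u in V) (u \notin R v)%:R.

Lemma missingE V v : missing V v = #|V :\: R v|%:R.
Proof.
rewrite -sum1_card natr_sum /missing big_mkcond [RHS]big_mkcond /=.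
by apply: eq_bigr => u _; rewrite inE; case: (u \in V); case: (u \in R v).
Qed.

Definition drift V v : F := missing V v / #|V|%:R - missing U v / #|U|%:R.

(** A fourth moment of the drifts, where [s] is the number of removals still to come: each removal
    gives up an allowance [3 * h], which compensates the second-order growth of the drift. *)
Definition potential (h : F) (V : {set T}) (s : nat) : F :=
  \sum_(v in U) (drift V v ^+ 2 + 3 * h * s%:R) ^+ 2.

Lemma missing_le V v : missing V v <= #|V|%:R.
Proof. by rewrite missingE ler_nat subset_leq_card // subsetDl. Qed.

(** Summing [potential_pointwise] over [v] leaves the linear term [4 w v * xi v]. Up to a positive
    factor, [y] is its gradient, and the balance hypothesis on [K] says exactly that the sum of
    [w v * xi v] is not positive. *)
Lemma potential_step (h : F) (V : {set T}) (s r : nat) (K : seq T) :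
  let w v := (drift V v ^+ 2 + 3 * h * s.+1%:R - 2 * h) * drift V v in
  let y u := - \sum_(v in U) w v * (u \notin R v)%:R in
  0 <= h -> uniq K -> size K = r -> {subset K <= V} -> (r < #|V|)%N ->
  (r%:R / (#|V| - r)%:R) ^+ 2 <= h ->
  #|V|%:R * \sum_(u <- K) y u <= r%:R * \sum_(u in V) y u ->
  potential h (V :\: [set x in K]) s <= potential h V s.+1.
Proof.
move=> w y h0 uK sK KV rV hh hy.
set N := #|V|; set V' := V :\: _.
have cA : #|[set x in K]| = r by rewrite cardsE (card_uniqP uK).
have AV : [set x in K] \subset V by apply/subsetP => z; rewrite inE => /KV.
have cV' : #|V'| = (N - r)%N by rewrite cardsD (setIidPr AV) cA.
have N0 : 0 < N%:R :> F by rewrite ltr0n; lia.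
have Nr0 : 0 < (N - r)%:R :> F by rewrite ltr0n subn_gt0.
pose k v : F := \sum_(u <- K) (u \notin R v)%:R.
have kE v : missing V' v = missing V v - k v.
  rewrite /missing (big_setID [set x in K] (A := V)) /= (setIidPr AV).
  have -> : \sum_(u in [set x in K]) (u \notin R v)%:R = k v.
    by rewrite /k big_uniq //; apply: eq_bigl => u; rewrite inE.
  by rewrite addrC addrK.
pose xi v := (r%:R * missing V v / N%:R - k v) / (N - r)%:R.
have dE v : drift V' v = drift V v + xi v.
  rewrite /drift kE cV' -/N /xi natrB; last exact: ltnW.
  have : N%:R - r%:R != 0 :> F by rewrite subr_eq0 eqr_nat gtn_eqF.
  move: (missing U v / _) => c nz; field.
  by rewrite nz gt_eqF.
have xih v : xi v ^+ 2 <= h.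
  apply: le_trans hh; rewrite -(real_normK (num_real (xi v))) /xi normrM normfV.
  rewrite [`|(N - r)%:R|]gtr0_norm // lerXn2r ?nnegrE ?divr_ge0 ?mulr_ge0 ?invr_ge0 //.
  rewrite ler_pM2r ?invr_gt0 // ler_norml.
  have k0 : 0 <= k v by apply: sumr_ge0.
  have kr : k v <= r%:R.
    rewrite -sK -[size K]sum1_size natr_sum; apply: ler_sum => u _.
    by case: (u \notin R v).
  have m0 : 0 <= missing V v / N%:R by rewrite divr_ge0 // missingE.
  have m1 : missing V v / N%:R <= 1 by rewrite ler_pdivrMr // mul1r missing_le.
  have r0 : 0 <= r%:R :> F by [].
  have := ler_wpM2l r0 m1; have := mulr_ge0 r0 m0; rewrite !mulrA mulr1.
  by move=> p1 p2; apply/andP; split; lra.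
have sumw : \sum_(v in U) w v * xi v <= 0.
  have e1 : \sum_(u <- K) y u = - \sum_(v in U) w v * k v.
    rewrite sumrN exchange_big /=; congr (- _); apply: eq_bigr => v _.
    by rewrite -mulr_sumr.
  have e2 : \sum_(u in V) y u = - \sum_(v in U) w v * missing V v.
    rewrite sumrN exchange_big /=; congr (- _); apply: eq_bigr => v _.
    by rewrite -mulr_sumr.
  rewrite e1 e2 !mulrN lerN2 -/N in hy.
  have -> : \sum_(v in U) w v * xi v =
     (r%:R * \sum_(v in U) w v * missing V v - N%:R * \sum_(v in U) w v * k v)
       / (N%:R * (N - r)%:R).
    rewrite !mulr_sumr -sumrB mulr_suml; apply: eq_bigr => v _; rewrite /xi; field.
    by rewrite !gt_eqF.
  by rewrite pmulr_lle0 ?invr_gt0 ?mulr_gt0 // subr_le0.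
rewrite /potential.
apply: (@le_trans _ _ (\sum_(v in U) ((drift V v ^+ 2 + 3 * h * s.+1%:R) ^+ 2 + 4 * w v * xi v))).
  apply: ler_sum => v _; rewrite dE.
  have := potential_pointwise (drift V v) h0 (xih v) (_ : 1 <= s.+1%:R :> F).
  have -> : s.+1%:R - 1 = s%:R :> F by rewrite -natr1 addrK.
  by apply; rewrite ler1n.
rewrite big_split /= gerDl.
under eq_bigr do rewrite -mulrA.
by rewrite -mulr_sumr pmulr_rle0.
Qed.

Lemma potential_drift (h : F) (V : {set T}) s v (dl : F) : v \in U -> 0 <= h ->
  0 <= dl -> potential h V s < dl ^+ 4 -> drift V v <= dl.
Proof.
move=> vU h0 dl0; apply: contraTT; rewrite -ltNge -leNgt => dv.
rewrite /potential (bigD1 v) //=; apply: ler_wpDr.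
  by apply: sumr_ge0 => u _; rewrite sqr_ge0.
rewrite (_ : dl ^+ 4 = (dl ^+ 2) ^+ 2); last by rewrite -exprM.
have d0 : 0 <= drift V v by rewrite (le_trans dl0) // ltW.
have hs : 0 <= 3 * h * s%:R by rewrite !mulr_ge0.
rewrite lerXn2r ?nnegrE ?sqr_ge0 ?addr_ge0 ?sqr_ge0 //.
by apply: ler_wpDr => //; rewrite lerXn2r ?nnegrE // ltW.
Qed.

End Step.

(** Initially the potential is of order [1 / n], because removal stops while a fixed proportion of
    the vertices remains. It never increases, so every drift stays below [g1 - g0] and
    [balancing r g1] applies throughout. *)
Lemma near_perfect (F : realType) (r : nat) (g0 g1 mu : F) : (0 < r)%N ->
  balancing r g1 -> g0 < g1 -> 0 < mu ->
  exists n0 : nat, forall (T : finType) (C : eqType) (G : ecgraph T C)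
    (R : T -> {set T}) (U : {set T}), rainbow_stars G R -> (n0 <= #|U|)%N ->
    {in U, forall v, #|U :\: R v|%:R <= g0 * #|U|%:R} ->
    exists L : {set T}, [/\ L \subset U, tileable G r (U :\: L) &
      #|L|%:R <= mu * #|U|%:R].
Proof.
move=> r0 [N0 hbal] g01 mu0.
pose dl := g1 - g0; have dl0 : 0 < dl by rewrite subr_gt0.
pose k0 := (Num.truncn (2 / mu)).+1.
have hk0 : 2 / mu <= k0%:R by apply/ltW/truncnS_gt.
(* With [m >= n / (2 k0)] the initial potential is at most [9 n (2 k0 r / n)^4 n^2], which equals
   [144 (k0 r)^4 / n]. *)
pose n1 := (Num.truncn (144 * (k0%:R * r%:R) ^+ 4 / dl ^+ 4)).+1.
have hn1 : 144 * (k0%:R * r%:R) ^+ 4 / dl ^+ 4 < n1%:R by apply: truncnS_gt.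
exists (n1 + k0 * (N0 + r + 1))%N => T C G R U hR hn hd.
set n := #|U| in hn hd *.
pose m := (n %/ k0)%N.
have k00 : (0 < k0)%N by [].
have mk : (m * k0 <= n)%N by apply: leq_trunc_div.
have hm : (N0 + r + 1 <= m)%N by rewrite leq_divRL // mulnC (leq_trans (leq_addl n1 _)).
have mn : (n < m.+1 * k0)%N by apply: ltn_ceil.
have n0 : (0 < n)%N by apply: leq_trans hn.
have n0' : 0 < n%:R :> F by rewrite ltr0n.
have m1 : (0 < m)%N by apply: leq_trans hm; rewrite addn1.
have m0' : 0 < m%:R :> F by rewrite ltr0n.
have mn2 : (n <= 2 * m * k0)%N.
  apply: (leq_trans (ltnW mn)); rewrite leq_mul2r; apply/orP; right.
  by rewrite mul2n -addnn -addn1 leq_add2l.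
pose h : F := (r%:R / m%:R) ^+ 2.
have h0 : 0 <= h by apply: sqr_ge0.
(* After [t1] removals between [m] and [m + r] vertices are left. *)
pose t1 := ((n - m) %/ r)%N.
have t1r : (t1 * r <= n - m)%N by apply: leq_trunc_div.
have t1n : (t1 <= n)%N by apply: leq_trans (leq_div _ _) (leq_subr _ _).
have t1r' : (n - m < t1.+1 * r)%N by apply: ltn_ceil.
have mlen : (m <= n)%N by apply: leq_div.
have psi0 : n%:R * (3 * h * t1%:R) ^+ 2 < dl ^+ 4.
  have rm : r%:R / m%:R <= 2 * (k0%:R * r%:R) / n%:R :> F.
    rewrite ler_pdivrMr // mulrAC ler_pdivlMr // -!natrM ler_nat.
    by rewrite (_ : (2 * (k0 * r) * m = r * (2 * m * k0))%N) ?leq_mul2l ?mn2 ?orbT //; ring.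
  have rm0 : 0 <= r%:R / m%:R :> F by rewrite divr_ge0.
  have hb : h ^+ 2 <= (2 * (k0%:R * r%:R) / n%:R) ^+ 4.
    by rewrite /h -exprM lerXn2r // nnegrE // (le_trans rm0).
  have tb : t1%:R ^+ 2 <= n%:R ^+ 2 :> F by rewrite lerXn2r ?nnegrE // ler_nat.
  apply: (@le_lt_trans _ _ (144 * (k0%:R * r%:R) ^+ 4 / n%:R)).
    have -> : n%:R * (3 * h * t1%:R) ^+ 2 = 9 * n%:R * (h ^+ 2 * t1%:R ^+ 2) by ring.
    have -> : 144 * (k0%:R * r%:R) ^+ 4 / n%:R =
        9 * n%:R * ((2 * (k0%:R * r%:R) / n%:R) ^+ 4 * n%:R ^+ 2) :> F.
      by field; rewrite gt_eqF.
    rewrite ler_wpM2l ?mulr_ge0 //; apply: ler_pM => //; exact: sqr_ge0.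
  rewrite ltr_pdivrMr // [ltRHS]mulrC -ltr_pdivrMr ?exprn_gt0 //.
  by apply: (lt_le_trans hn1); rewrite ler_nat (leq_trans (leq_addr _ _) hn).
have inv t : (t <= t1)%N -> exists V : {set T},
    [/\ V \subset U, #|V| = (n - r * t)%N, tileable G r (U :\: V) &
      potential R U h V (t1 - t) <= n%:R * (3 * h * t1%:R) ^+ 2].
  elim: t => [_|t IH tt].
    exists U; split=> //.
    - by rewrite muln0 subn0.
    - by rewrite setDv tileable0.
    - rewrite /potential subn0.
      have -> : n%:R * (3 * h * t1%:R) ^+ 2 = \sum_(v in U) (3 * h * t1%:R) ^+ 2.
        by rewrite sumr_const mulr_natl.
      by apply: ler_sum => v _; rewrite /drift subrr expr0n add0r.
  have [V [VU cV tV pV]] := IH (ltnW tt).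
  have tr : (t.+1 * r <= n - m)%N by apply: leq_trans t1r; rewrite leq_mul2r tt orbT.
  have hV : (m + r <= #|V|)%N.
    by rewrite cV leq_subRL mulnC; move: tr mlen; rewrite mulSn; clear; lia.
  have dV : {in V, forall v, #|V :\: R v|%:R <= g1 * #|V|%:R}.
    move=> v vV; have vU := subsetP VU v vV.
    have := potential_drift vU h0 (ltW dl0) (le_lt_trans pV psi0).
    have V0 : 0 < #|V|%:R :> F by rewrite ltr0n (leq_trans m1) // (leq_trans _ hV) // leq_addr.
    rewrite /drift !missingE -/n => hdr.
    have hU : #|U :\: R v|%:R / n%:R <= g0 by rewrite ler_pdivrMr // hd.
    have : #|V :\: R v|%:R / #|V|%:R <= g1 by move: hdr; rewrite /dl; lra.
    by rewrite ler_pdivrMr.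
  pose w v := (drift F R U V v ^+ 2 + 3 * h * (t1 - t.+1).+1%:R - 2 * h) * drift F R U V v.
  have N0V : (N0 <= #|V|)%N.
    apply: leq_trans hV; apply: leq_trans (leq_addr _ _); apply: leq_trans hm.
    by rewrite -addnA leq_addr.
  have [K [vK sK KV hK]] := hbal _ _ _ _ V hR N0V dV
    (fun u => - \sum_(v in U) w v * (u \notin R v)%:R).
  have uK := valid_uniq vK.
  have AV : [set x in K] \subset V by apply/subsetP => z; rewrite inE => /KV.
  have cA : #|[set x in K]| = r by rewrite cardsE (card_uniqP uK).
  exists (V :\: [set x in K]); split.
  - by apply: subset_trans VU; apply: subsetDl.
  - by rewrite cardsD (setIidPr AV) cA cV mulnS addnC subnDA.
  - have -> : U :\: (V :\: [set x in K]) = (U :\: V) :|: [set x in K].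
      rewrite setDDr; congr (_ :|: _); apply/setIidPr.
      exact: subset_trans AV VU.
    apply: tileableU => //; last exact: tileable_clique.
    rewrite disjoint_sym (disjointWl AV) // disjoint_sym.
    by rewrite -setI_eq0; apply/eqP/setP => z; rewrite !inE; case: (z \in V); rewrite ?andbF.
  - apply: le_trans pV; rewrite -(subnSK tt).
    have rV : (r < #|V|)%N by apply: leq_trans hV; rewrite -add1n leq_add2r.
    apply: (potential_step (r := r)) => //.
    rewrite /h lerXn2r ?nnegrE ?divr_ge0 // ler_wpM2l // lef_pV2 ?posrE ?ltr0n ?subn_gt0 //.
    by rewrite ler_nat leq_subRL ?(ltnW rV) // addnC.
have [V [VU cV tV _]] := inv t1 (leqnn _).
exists V; split=> //.
have cV' : (#|V| <= m + r)%N by rewrite cV; move: t1r' mlen; rewrite mulSn mulnC; clear; lia.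
apply: (@le_trans _ _ (m + r)%:R); first by rewrite ler_nat.
have h1 : (m + r)%:R * k0%:R <= 2 * n%:R :> F.
  rewrite -!natrM ler_nat mulnDl mul2n -addnn leq_add // mulnC.
  apply: leq_trans (leq_trans (leq_addl n1 _) hn).
  by rewrite leq_mul2l; apply/orP; right; rewrite addnAC leq_addl.
have h2 : 2 <= mu * k0%:R by rewrite mulrC -ler_pdivrMr.
have k0' : 0 < k0%:R :> F by rewrite ltr0n.
rewrite -(ler_pM2r k0') (le_trans h1) // mulrAC ler_wpM2r //.
Qed.

End NearPerfect.

(** * Absorbers for tuples of vertices *)

Section Absorbers.
Variables (T : finType) (C : eqType) (G : ecgraph T C) (r : nat).
Local Notation tileable := (tileable G r).

Definition absorbs (l g : seq T) : bool :=
  [&& uniq g, all (fun z => z \notin l) g, tileable [set z in g] &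
      tileable ([set z in g] :|: [set z in l])].

Lemma mem_catrev (s K : seq T) z : (z \in catrev s K) = (z \in s) || (z \in K).
Proof. by rewrite catrevE mem_cat mem_rev. Qed.

Section Rich.
Variables (R : T -> {set T}) (hR : rainbow_stars G R).
Variables (D b w0 : nat) (hD : deficiency R [set: T] D).
Hypotheses (r_gt1 : 1 < r) (b_gt0 : 0 < b).
(** [2 * D] accounts for the vertices outside [R x] or [R y], [w0] for those to be avoided; the rest
    is what [many_cliques] needs for [r.-1] picks. *)
Hypothesis room : 2 * D + w0 + ((r - 2) * (2 * (D + slack r) + b) + b) <= #|T|.

Lemma exchange_many x y (W : {set T}) : #|W| <= w0 ->
  many b r.-1 (fun S => [&& valid G (catrev S [:: x]), valid G (catrev S [:: y]) &
                            all (fun z => z \notin W) S]).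
Proof.
move=> hW; pose X := (R x :&: R y) :\: W.
have szX : (r - 2) * (2 * (D + slack r) + b) + b <= #|X|.
  have h1 : #|[set: T] :\: R x| <= D by apply: hD.
  have h2 : #|[set: T] :\: R y| <= D by apply: hD.
  have : #|[set: T]| <= #|X :|: (([set: T] :\: R x) :|: (([set: T] :\: R y) :|: W))|.
    apply: subset_leq_card; apply/subsetP => z _; rewrite !inE.
    by case: (z \in W); case: (z \in R x); case: (z \in R y).
  have h3 : #|X :|: (([set: T] :\: R x) :|: (([set: T] :\: R y) :|: W))|
      <= #|X| + (D + (D + w0)).
    apply: (leq_trans (leq_card_setU _ _)); rewrite leq_add2l.
    apply: (leq_trans (leq_card_setU _ _)); apply: leq_add => //.
    by apply: (leq_trans (leq_card_setU _ _)); apply: leq_add.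
  by rewrite cardsT; move: room h3; clear; lia.
have hX : cand G R [:: [:: x]; [:: y]] X.
  move=> w; rewrite !inE => /and3P [_ wx wy] K; rewrite !inE => /orP [] /eqP ->;
  by split; [rewrite valid_consE /= ecg_sym (proj1 hR) | move=> v; rewrite inE => /eqP ->].
apply: (many_mono _ (many_cliques (r := r) (b := b) (k := r.-1) hR hD (subsetT X) hX _ _ _ _)) => //.
- move=> S _ /= /andP [/and3P [-> -> _] /allP hS]; apply/allP => z /hS /=.
  by rewrite inE => /andP [].
- by move=> K; rewrite !inE => /orP [] /eqP ->; split=> //=; rewrite add1n prednK // ltnW.
- by have -> : r.-1.-1 = r - 2 by rewrite -subn1 -subn1 -subnDA.
Qed.

(** The exchange sets of the pairs are chosen one after another, each avoiding [W] and the earlier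
    sets; their union is then tileable with all first entries as well as with all second entries. *)
Lemma exchange_pairs_many (ps : seq (T * T)) (W : {set T}) :
  #|W| + size ps * r.-1 <= w0 -> uniq (unzip1 ps) -> uniq (unzip2 ps) ->
  {subset unzip1 ps <= W} -> {subset unzip2 ps <= W} ->
  many b (size ps * r.-1) (fun g => [&& uniq g, all (fun z => z \notin W) g,
    tileable ([set z in g] :|: [set z in unzip1 ps]) &
    tileable ([set z in g] :|: [set z in unzip2 ps])]).
Proof.
elim: ps W => [|[x y] ps IH] W /=.
  move=> _ _ _ _ _; have -> : [set z in [::]] = set0 :> {set T} by apply/setP => z; rewrite !inE.
  by rewrite setU0 tileable0.
rewrite mulSn => hW /andP [nx ux] /andP [ny uy] sx sy.
have hW' : #|W| <= w0 by apply: leq_trans hW; apply: leq_addr.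
apply: many_cat; apply: (many_mono _ (exchange_many x y hW')) => S sS /and3P [vx vy /allP aS].
pose W' := W :|: [set z in S].
have cW' : #|W'| + size ps * r.-1 <= w0.
  apply: leq_trans hW; rewrite addnA leq_add2r.
  apply: (leq_trans (leq_card_setU _ _)); rewrite leq_add2l -sS cardsE; exact: card_size.
have := IH W' cW' ux uy.
have sub (f : seq T) a : {subset a :: f <= W} -> {subset f <= W'}.
  by move=> h z zf; rewrite inE (h z) // inE zf orbT.
move=> /(_ (sub _ _ sx) (sub _ _ sy)); apply: many_mono => t st /and4P [ut /allP at_ t1 t2].
have tW z : z \in t -> z \notin W /\ z \notin S.
  by move=> /at_; rewrite !inE negb_or => /andP.
have key (a : T) (f : seq T) : valid G (catrev S [:: a]) -> a \notin f ->
    {subset a :: f <= W} -> tileable ([set z in t] :|: [set z in f]) ->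
    tileable ([set z in S ++ t] :|: [set z in a :: f]).
  move=> va na sf tf.
  have -> : [set z in S ++ t] :|: [set z in a :: f] =
      [set z in catrev S [:: a]] :|: ([set z in t] :|: [set z in f]).
    apply/setP => z; rewrite !inE mem_cat mem_catrev inE.
    by case: (z \in S); case: (z \in t); case: (z == a); case: (z \in f).
  apply: tileableU => //; last first.
    apply: tileable_clique => //.
    by rewrite catrevE size_cat size_rev sS addn1 prednK // ltnW.
  rewrite -setI_eq0; apply/eqP/setP => z; rewrite !inE mem_catrev inE.
  apply/negbTE/negP => /andP [/orP [zS|/eqP za] /orP [zt|zf]].
  - by have [_] := tW z zt; rewrite zS.
  - by move: (aS z zS); rewrite sf // inE zf orbT.
  - by have [] := tW z zt; rewrite za sf // mem_head.
  - by rewrite -za zf in na.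
apply/and4P; split; last 2 first.
- exact: key.
- exact: key.
- rewrite cat_uniq ut andbT; apply/andP; split.
    by move: (valid_uniq vx); rewrite catrevE cat_uniq rev_uniq => /andP [].
  by apply/hasPn => z /tW [].
- rewrite all_cat; apply/andP; split; apply/allP => z; first exact: aS.
  by move=> /tW [].
Qed.

(** The absorber is a rainbow clique [A] with an exchange set for each pair of an entry of [l] and
    one of [A]. Alone, these sets are tiled with [A]; together with [l], they are tiled with [l] and
    [A] is a tile of its own. *)
Lemma absorbers_many (l : seq T) (W : {set T}) : uniq l -> size l = r ->
  #|W| + (2 * r + r * r.-1) <= w0 ->
  many b (r + r * r.-1) (fun g => absorbs l g && all (fun z => z \notin W) g).
Proof.
move=> ul sl hW; apply: many_cat.
pose W1 := W :|: [set z in l].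
have cl : #|[set z in l]| <= r by rewrite -sl cardsE card_size.
have cW1 : #|W1| <= #|W| + r.
  by apply: (leq_trans (leq_card_setU _ _)); rewrite leq_add2l.
have hW1 : #|W1| <= w0 by move: cW1 hW; clear; lia.
have bW : b <= #|~: W1|.
  have : #|W1| + #|~: W1| = #|T| by rewrite cardsC.
  by move: room hW1; move: ((r - 2) * _) => p; clear; lia.
rewrite -{1}(prednK (ltnW r_gt1)) /=; apply: (leq_trans bW); apply: subset_leq_card.
apply/subsetP => a; rewrite !inE => /norP [aW al].
(* With equal endpoints the exchange set merely completes [a] to a rainbow clique. *)
apply: (many_mono _ (exchange_many a a hW1)) => S sS /and3P [va _ /allP aS].
set A := catrev S [:: a] in va.
have sA : size A = r by rewrite /A catrevE size_cat size_rev sS addn1 prednK // ltnW.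
have uA := valid_uniq va.
have A1 z : z \in A -> (z \notin W) && (z \notin l).
  rewrite /A mem_catrev inE => /orP [/aS|/eqP ->]; last by rewrite aW al.
  by rewrite !inE negb_or.
pose W2 := W1 :|: [set z in A].
have cW2 : #|W2| + size (zip l A) * r.-1 <= w0.
  have : #|W2| <= #|W1| + r.
    by apply: (leq_trans (leq_card_setU _ _)); rewrite leq_add2l -sA cardsE card_size.
  by rewrite size_zip sl sA minnn; move: cW1 hW; clear; lia.
have sz : size l = size A by rewrite sl sA.
have := @exchange_pairs_many (zip l A) W2 cW2.
rewrite unzip1_zip ?sz // unzip2_zip ?sz // size_zip sz minnn sA.
have sl2 : {subset l <= W2} by move=> z zl; rewrite !inE zl orbT.
have sA2 : {subset A <= W2} by move=> z zA; rewrite !inE zA orbT.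
move=> /(_ ul uA sl2 sA2); apply: many_mono => t st /and4P [ut /allP at_ t1 t2].
have tW z : z \in t -> [/\ z \notin W, z \notin l & z \notin A].
  by move=> /at_; rewrite !inE !negb_or => /andP [/andP [? ?] ?]; split.
have mA z : (z \in a :: S) = (z \in A) by rewrite /A mem_catrev !inE orbC.
have eA : [set z in (a :: S) ++ t] = [set z in t] :|: [set z in A].
  by apply/setP => z; rewrite in_set mem_cat mA !in_set orbC.
rewrite /absorbs eA t2 -setUA [X in tileable (_ :|: X)]setUC setUA.
have hall (P : pred T) : {in A, forall z, P z} -> {in t, forall z, P z} ->
    all P ((a :: S) ++ t).
  move=> hA ht; rewrite all_cat; apply/andP; split; apply/allP => z; last exact: ht.
  by rewrite mA; apply: hA.
apply/andP; split; last first.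
  by apply: hall => z; [move=> /A1 /andP [] | move=> /tW []].
apply/and4P; split => //.
- rewrite -cat_cons cat_uniq ut andbT; apply/andP; split; last first.
    by apply/hasPn => z /tW [_ _]; rewrite mA.
  by move: uA; rewrite /A catrevE cats1 rcons_uniq mem_rev rev_uniq.
- by apply: hall => z; [move=> /A1 /andP [] | move=> /tW []].
- apply: tileableU => //; last exact: tileable_clique.
  rewrite -setI_eq0; apply/eqP/setP => z; rewrite !inE.
  apply/negbTE/negP => /andP [/orP [/tW [_ _ /negP]|zl] zA //].
  by have /andP [_] := A1 z zA; rewrite zl.
Qed.

End Rich.

Lemma absorb_all (Ls gs : seq (seq T)) :
  uniq (flatten gs ++ flatten Ls) -> all (fun g => tileable [set z in g]) gs ->
  {in Ls, forall l, size Ls <= count (absorbs l) gs} ->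
  tileable ([set z in flatten gs] :|: [set z in flatten Ls]).
Proof.
elim: Ls gs => [|l Ls IH] gs /=.
  rewrite cats0 => + + _.
  have -> : [set z in [::]] = set0 :> {set T} by apply/setP => z; rewrite !inE.
  rewrite setU0; elim: gs => [|g gs IHg] /=.
    by rewrite (_ : [set z in [::]] = set0) ?tileable0 //; apply/setP => z; rewrite !inE.
  rewrite cat_uniq => /and3P [_ /hasPn dg ug] /andP [tg tgs].
  have -> : [set z in g ++ flatten gs] = [set z in g] :|: [set z in flatten gs].
    by apply/setP => z; rewrite !inE mem_cat.
  apply: tileableU => //; last exact: IHg.
  rewrite -setI_eq0; apply/eqP/setP => z; rewrite !inE.
  by apply/negbTE/negP => /andP [zg /dg /negP].
move=> u tgs cnt.
have /hasP [g gin ag] : has (absorbs l) gs.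
  by rewrite has_count; apply: leq_trans (cnt l (mem_head _ _)).
have pgs := perm_to_rem gin; set gs' := rem g gs in pgs.
have pf : perm_eq (flatten gs) (g ++ flatten gs') by apply: (perm_flatten pgs).
have mf z : (z \in flatten gs) = (z \in g) || (z \in flatten gs').
  by rewrite (perm_mem pf) mem_cat.
have u' : uniq ((g ++ l) ++ (flatten gs' ++ flatten Ls)).
  rewrite -(perm_uniq (s1 := flatten gs ++ (l ++ flatten Ls))) //.
  apply: (perm_trans (perm_cat pf (perm_refl _))).
  by rewrite -!catA perm_cat2l !catA perm_cat2r perm_catC.
have -> : [set z in flatten gs] :|: [set z in l ++ flatten Ls] =
    ([set z in g] :|: [set z in l]) :|: ([set z in flatten gs'] :|: [set z in flatten Ls]).
  apply/setP => z; rewrite !inE mf mem_cat.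
  by case: (z \in g); case: (z \in l); case: (z \in flatten gs').
move: u'; rewrite cat_uniq => /and3P [_ /hasPn dis u2].
apply: tileableU.
- rewrite -setI_eq0; apply/eqP/setP => z; rewrite !inE -!mem_cat.
  by apply/negbTE/negP => /andP [z1 /dis /negP].
- by case/and4P: ag.
- apply: IH => //.
    by apply/allP => h hin; apply: (allP tgs); apply: mem_rem hin.
  move=> l' l'in; have := cnt l' (_ : l' \in l :: Ls).
  rewrite inE l'in orbT => /(_ isT); rewrite (permP pgs) /=.
  by case: (absorbs l' g); rewrite ?add1n ?add0n // => /ltnW.
Qed.

End Absorbers.

(** * A disjoint family absorbing every tuple many times *)

Section AbsorbingFamily.
Local Open Scope ring_scope.

(** A random sequence satisfies each [phi i] with probability at least [(b / #|T|) ^ k]; the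
    sequence is built entry by entry, each chosen by averaging over [T]. *)
Lemma many_average (F : realType) (T I : finType) (P : pred I) (wt : I -> F)
    (b k : nat) (phi : I -> pred (seq T)) : (0 < #|T|)%N ->
  (forall i, 0 <= wt i) -> (forall i, P i -> many b k (phi i)) ->
  exists2 s, size s = k &
    (b%:R / #|T|%:R) ^+ k * \sum_(i | P i) wt i <= \sum_(i | P i && phi i s) wt i.
Proof.
move=> T0 wt0; elim: k P phi => [|k IH] P phi hP.
  exists [::] => //; rewrite expr0 mul1r (eq_bigl (fun i => P i && phi i [::])) //.
  by move=> i; case Pi: (P i) => //=; have /= -> := hP i Pi.
pose S (u : T) := \sum_(i | P i && many b k (fun s => phi i (u :: s))) wt i.
have n0 : 0 < #|T|%:R :> F by rewrite ltr0n.
have [/existsP [u hu]|no] := boolP [exists u, b%:R / #|T|%:R * \sum_(i | P i) wt i <= S u].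
  have [i /andP [_ hi]//|s ss hs] :=
    IH (fun i => P i && many b k (fun s => phi i (u :: s))) (fun i s => phi i (u :: s)).
  exists (u :: s); first by rewrite /= ss.
  rewrite exprSr -mulrA; apply: (@le_trans _ _ ((b%:R / #|T|%:R) ^+ k * S u)).
    by rewrite ler_wpM2l // exprn_ge0 // divr_ge0.
  apply: (le_trans hs); rewrite [leRHS]big_mkcond [leLHS]big_mkcond /=.
  apply: ler_sum => i _; case: (P i) => //=; case: (phi i _); rewrite ?andbF ?andbT //.
  by case: ifP.
have lt : \sum_u S u < \sum_(u : T) (b%:R / #|T|%:R * \sum_(i | P i) wt i).
  have /card_gt0P [u0 _] := T0.
  apply: ltr_sum; first by apply/hasP; exists u0; rewrite // mem_index_enum.
  by move=> u _; rewrite ltNge; move/existsPn: no; apply.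
have ge : b%:R * \sum_(i | P i) wt i <= \sum_u S u.
  rewrite /S (exchange_big_dep P) /=; last by move=> u i _ /andP [].
  rewrite mulr_sumr; apply: ler_sum => i Pi.
  rewrite (eq_bigl (fun u => u \in [set u | many b k (fun s => phi i (u :: s))])); last first.
    by move=> u; rewrite Pi inE.
  rewrite sumr_const -[leRHS]mulr_natl ler_wpM2r // ler_nat; exact: (hP i Pi).
move: (le_lt_trans ge lt); rewrite sumr_const -[ltRHS]mulr_natl.
have -> : #|T|%:R * (b%:R / #|T|%:R * \sum_(i | P i) wt i) = b%:R * \sum_(i | P i) wt i.
  by rewrite mulrA mulrCA divff ?gt_eqF // mulr1.
by rewrite ltxx.
Qed.

(** Bernoulli's inequality in the form [(1 - x)^q (1 + q x) <= 1], with [q x >= 3]. *)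
Lemma pow_le_quarter (F : realType) (x : F) : 0 < x -> x <= 1 ->
  exists2 q : nat, (0 < q)%N & (1 - x) ^+ q <= 4^-1.
Proof.
move=> x0 x1.
have bern q : (1 - x) ^+ q * (1 + q%:R * x) <= 1.
  elim: q => [|q IH]; first by rewrite expr0 mul0r addr0 mulr1.
  apply: le_trans IH; rewrite exprSr -mulrA ler_wpM2l ?exprn_ge0 ?subr_ge0 //.
  have q0 : 0 <= q%:R :> F by [].
  have := mulr_ge0 (mulr_ge0 q0 (ltW x0)) (ltW x0); have := mulr_ge0 (ltW x0) (ltW x0).
  by rewrite -natr1; lra.
exists (Num.truncn (3 / x)).+1 => //; set q := (Num.truncn _).+1.
have hq : 4 <= 1 + q%:R * x.
  have : 3 / x < q%:R by apply: truncnS_gt.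
  by rewrite ltr_pdivrMr //; lra.
have p0 : 0 <= (1 - x) ^+ q by rewrite exprn_ge0 // subr_ge0.
have := ler_wpM2l p0 hq; have := bern q; lra.
Qed.

Lemma pow_le_exp (r B : nat) : (0 < B)%N ->
  exists n0 : nat, forall n, (n0 <= n)%N -> (n ^ r <= 2 ^ (n %/ B))%N.
Proof.
move=> B0; case: r => [|r]; first by exists 0%N => n _; rewrite expn0 expn_gt0.
pose M := (2 * r.+1 * B)%N.
have M0 : (0 < M)%N by rewrite !muln_gt0.
exists (M * M)%N => n hn; pose u := (n %/ M)%N.
have uM : (M <= u)%N by rewrite leq_divRL.
have nu : (n <= (2 ^ u) ^ 2)%N.
  apply: (leq_trans (ltnW (ltn_ceil n M0))); rewrite expnS expn1 leq_mul //.
    exact: ltn_expl.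
  by apply: (leq_trans uM); rewrite ltnW // ltn_expl.
apply: (@leq_trans (((2 ^ u) ^ 2) ^ r.+1)); first by rewrite leq_exp2r.
rewrite -!expnM leq_exp2l // leq_divRL // -!mulnA mulnA.
by rewrite [X in (_ <= X)%N](divn_eq n M) -/u /M; lia.
Qed.

Section Family.
Variables (F : realType) (T : finType) (C : eqType) (G : ecgraph T C) (r : nat).
Variables (R : T -> {set T}) (hR : rainbow_stars G R).
Variables (D b w0 : nat) (hD : deficiency R [set: T] D).
Hypotheses (r_gt1 : (1 < r)%N) (b_gt0 : (0 < b)%N) (r_leT : (r <= #|T|)%N).
Hypothesis room : (2 * D + w0 + ((r - 2) * (2 * (D + slack r) + b) + b) <= #|T|)%N.
Local Notation m := (r + r * r.-1)%N.
Local Notation rho := ((b%:R / #|T|%:R) ^+ m : F).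

(** Every tuple [l] has weight [2 ^ -count]. By [many_average] some new [g] absorbs tuples carrying
    a proportion [rho] of the total weight; halving these multiplies the total by at most
    [1 - rho / 2]. *)
Lemma absorbing_family k : (k * m + (2 * r + r * r.-1) <= w0)%N ->
  exists gs : seq (seq T), [/\ size gs = k, uniq (flatten gs),
    all (fun g => tileable G r [set z in g]) gs, all (fun g => size g == m) gs &
    \sum_(l : r.-tuple T | uniq l) (2^-1) ^+ count (absorbs G r l) gs
      <= #|T|%:R ^+ r * (1 - rho / 2) ^+ k].
Proof.
have T0 : (0 < #|T|)%N by apply: leq_trans r_leT; apply: ltnW.
elim: k => [|k IH] hk.
  exists [::]; split=> //=; rewrite expr0 mulr1.
  apply: (@le_trans _ _ (\sum_(l : r.-tuple T) 1)).
    by rewrite [leLHS]big_mkcond /=; apply: ler_sum => l _; case: ifP; rewrite ?expr0.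
  by rewrite sumr_const card_tuple natrX.
have hk' : (k * m + (2 * r + r * r.-1) <= w0)%N.
  by apply: leq_trans hk; rewrite leq_add2r leq_mul2r leqnSn orbT.
have [gs [sgs ugs tgs zgs pgs]] := IH hk'.
pose W := [set z in flatten gs].
have cW : (#|W| <= k * m)%N.
  rewrite cardsE; apply: (leq_trans (card_size _)).
  rewrite size_flatten /shape sumnE big_map -sgs.
  by apply: sum_seq_le => g gin; rewrite (eqP (allP zgs g gin)).
have hW : (#|W| + (2 * r + r * r.-1) <= w0)%N.
  by apply: leq_trans hk'; rewrite leq_add2r.
pose wt (l : r.-tuple T) : F := (2^-1) ^+ count (absorbs G r l) gs.
have wt0 l : 0 < wt l by rewrite exprn_gt0 // invr_gt0.
have [l|g sg hg] := @many_average F T _ (fun l : r.-tuple T => uniq l) wt b m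
    (fun l g => absorbs G r l g && all (fun z => z \notin W) g) T0 (fun l => ltW (wt0 l)).
  by move=> ul; apply: (absorbers_many hR hD r_gt1 b_gt0 room); rewrite ?size_tuple.
have S0 : 0 < \sum_(l : r.-tuple T | uniq l) wt l.
  have ss : size (take r (enum T)) == r by rewrite size_takel // -cardE.
  rewrite (bigD1 (Tuple ss)) /=; last by rewrite take_uniq // enum_uniq.
  by apply: ltr_wpDr => //; apply: sumr_ge0 => l _; apply: ltW.
have rho0 : 0 < rho by rewrite exprn_gt0 // divr_gt0 // ltr0n.
(* Since the total weight is positive, [g] absorbs some tuple; hence it is duplicate-free, tileable
   and disjoint from the earlier sets. *)
have [l0 /andP [_ /andP [ab0 /allP av]]] : exists l : r.-tuple T,
    uniq l && (absorbs G r l g && all (fun z => z \notin W) g).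
  apply/existsP; apply: contraLR (mulr_gt0 rho0 S0) => /existsPn none.
  by rewrite -leNgt (le_trans hg) // big_pred0 // => l; apply/negbTE/none.
have [ug _ tg _] := and4P ab0.
exists (g :: gs); split=> /=.
- by rewrite sgs.
- rewrite cat_uniq ug ugs andbT /=; apply/hasPn => z zW.
  by apply/negP => /av; rewrite inE zW.
- by rewrite tg.
- by rewrite sg eqxx.
apply: (@le_trans _ _ ((1 - rho / 2) * \sum_(l : r.-tuple T | uniq l) wt l)); last first.
  rewrite exprS mulrCA ler_wpM2l //.
  have : rho <= 1.
    rewrite exprn_ile1 ?divr_ge0 // ler_pdivrMr ?ltr0n // mul1r ler_nat.
    by apply: leq_trans room; rewrite addnA leq_addl.
  by lra.
have hg' : rho * \sum_(l : r.-tuple T | uniq l) wt l <=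
    \sum_(l : r.-tuple T | uniq l && absorbs G r l g) wt l.
  apply: (le_trans hg); rewrite [leLHS]big_mkcond [leRHS]big_mkcond /=.
  apply: ler_sum => l _; case: (uniq l) => //=; case: (absorbs _ _ l g) => //=.
  by case: ifP => // _; apply: ltW.
have -> : \sum_(l : r.-tuple T | uniq l) (2^-1) ^+ (absorbs G r l g + count (absorbs G r l) gs)
   = \sum_(l : r.-tuple T | uniq l) wt l
     - 2^-1 * \sum_(l : r.-tuple T | uniq l && absorbs G r l g) wt l.
  rewrite [X in _ - _ * X]big_mkcondr mulr_sumr -sumrB; apply: eq_bigr => l _.
  rewrite exprD -/(wt l); case: (absorbs _ _ _ _); rewrite ?expr1 ?expr0 ?mul1r ?mulr0 ?subr0 //.
  by lra.
move: hg'; lra.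
Qed.

(** A tuple with fewer than [j] absorbers would alone weigh more than [2 ^ -j], whereas the total is
    at most [2 ^ j * 4 ^ -j]. *)
Lemma absorbers_count (gs : seq (seq T)) (j k q : nat) (c : F) :
  \sum_(l : r.-tuple T | uniq l) (2^-1) ^+ count (absorbs G r l) gs
      <= #|T|%:R ^+ r * (1 - rho / 2) ^+ k ->
  0 <= c -> 1 - rho / 2 <= c -> c ^+ q <= 4^-1 -> (q * j <= k)%N ->
  (#|T| ^ r <= 2 ^ j)%N -> 0 <= 1 - rho / 2 -> c <= 1 ->
  forall l : r.-tuple T, uniq l -> (j <= count (absorbs G r l) gs)%N.
Proof.
move=> hs c0 hc hq hk hn rh c1 l ul; rewrite leqNgt; apply/negP => lt.
have h1 : (2^-1) ^+ count (absorbs G r l) gs <= (2 ^+ j * (4^-1) ^+ j : F).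
  apply: (@le_trans _ _ (\sum_(l : r.-tuple T | uniq l) (2^-1) ^+ count (absorbs G r l) gs)).
    rewrite (bigD1 l) //= lerDl; apply: sumr_ge0 => ? _.
    by rewrite exprn_ge0 // invr_ge0.
  apply: (le_trans hs); apply: ler_pM; rewrite ?exprn_ge0 //.
    by rewrite -!natrX ler_nat.
  apply: (@le_trans _ _ (c ^+ k)); first by rewrite lerXn2r ?nnegrE.
  apply: (@le_trans _ _ (c ^+ (q * j))).
    by rewrite -(subnK hk) exprD ler_piMl ?exprn_ge0 // exprn_ile1.
  by rewrite exprM lerXn2r ?nnegrE ?exprn_ge0 // invr_ge0.
have e : 2 * 4^-1 = 2^-1 :> F.
  by rewrite [4](natrM _ 2 2) invfM mulrA divff ?mul1r // pnatr_eq0.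
rewrite -exprMn e in h1.
have : (2^-1) ^+ j < (2^-1) ^+ count (absorbs G r l) gs :> F.
  by rewrite ltr_iXn2l // ?invr_gt0 // invf_lt1 // ltr1n.
by rewrite ltNge h1.
Qed.

End Family.
End AbsorbingFamily.

(** * From balanced cliques and absorbers to a perfect tiling *)

Section Assembly.
Local Open Scope ring_scope.

(** [balancing r g1] serves the almost perfect tiling; the bound on [(2 * r - 2) * g] serves
    absorption, where [2 D] is lost to two stars and [2 D] to each of [r - 2] picks. *)
Lemma tiling_of_balancing (F : realType) (r : nat) (g g1 : F) : (1 < r)%N ->
  0 <= g -> g < g1 -> (2 * r - 2)%:R * g < 1 -> balancing r g1 ->
  exists n0 : nat, forall (T : finType) (C : eqType) (G : ecgraph T C)
    (R : T -> {set T}), rainbow_stars G R -> (n0 <= #|T|)%N -> (r %| #|T|)%N ->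
    (forall v, #|~: R v|%:R <= g * #|T|%:R) -> tileable G r [set: T].
Proof.
move=> r1 g0 gg1 rg hbal.
have r0 : (0 < r)%N by apply: ltnW.
pose sg := 1 - (2 * r - 2)%:R * g; have sg0 : 0 < sg by rewrite subr_gt0.
have gap : 0 < g1 - g by rewrite subr_gt0.
(* With [b = n %/ B], the first term makes [r * b] at most [sg / 2 * n]; the second ensures
   [g n <= h #|U|] once at most [b] vertices are set aside. *)
pose B := (Num.truncn (2 * r%:R / sg + (g + g1) / (g1 - g))).+2.
have t1 : 0 <= 2 * r%:R / sg by rewrite divr_ge0 ?mulr_ge0 // ltW.
have g10 : 0 <= g1 := ltW (le_lt_trans g0 gg1).
have t2 : 0 <= (g + g1) / (g1 - g) by apply: divr_ge0; [apply: addr_ge0 | apply: ltW].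
have hB : 2 * r%:R / sg + (g + g1) / (g1 - g) <= B%:R.
  by apply/ltW/(lt_le_trans (truncnS_gt _)); rewrite ler_nat.
have B1 : 2 * r%:R / sg <= B%:R by apply: le_trans hB; rewrite lerDl.
have B2' : (g + g1) / (g1 - g) <= B%:R by apply: le_trans hB; rewrite lerDr.
have Bpos : 0 < B%:R :> F by rewrite ltr0n.
pose m := (r + r * r.-1)%N.
have m0 : (0 < m)%N by rewrite addn_gt0 r0.
(* The family has [n %/ B2] sets of size [m]; the factor 2 leaves room for the constant [c0] within
   [b]. *)
pose B2 := (2 * m * B)%N.
have B20 : (0 < B2)%N by rewrite !muln_gt0 m0.
(* A lower bound for [rho / 2] independent of [n], as [b / n >= 1 / (2 B)]. *)
pose x := (((2 * B)%:R^-1) ^+ m) / 2 : F.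
have x0 : 0 < x by rewrite divr_gt0 // exprn_gt0 // invr_gt0 ltr0n muln_gt0.
have BB1 : ((2 * B)%:R^-1) ^+ m <= 1 :> F.
  by rewrite exprn_ile1 ?invr_ge0 // invf_le1 ?ltr0n ?muln_gt0 // ler1n muln_gt0.
have x1 : x <= 1 by rewrite ler_pdivrMr // mul1r (le_trans BB1) // ler1n.
have [q q0 hq] := pow_le_quarter x0 x1.
(* The leftover then has at most [n / (2 B2 q)] vertices, hence at most [j = n %/ (B2 * q)], the
   number of absorbers of every tuple. *)
pose mu : F := (2 * (B2 * q))%:R^-1.
have Bq0 : (0 < B2 * q)%N by rewrite muln_gt0 B20.
have mu0 : 0 < mu by rewrite invr_gt0 ltr0n muln_gt0 Bq0.
pose h := (g + g1) / 2.
have hg1 : h < g1 by rewrite /h; lra.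
have [n1 near] := near_perfect r0 hbal hg1 mu0.
have [n2 hpow] := pow_le_exp r Bq0.
pose c0 := (2 * r + r * r.-1)%N.
pose sl := ((r - 2) * (2 * slack r))%N.
pose n3 := (Num.truncn (2 * sl%:R / sg)).+1.
have hn3 : 2 * sl%:R / sg <= n3%:R by apply/ltW/truncnS_gt.
exists (2 * n1 + (n2 + (n3 + (B + (B2 * c0 + (B2 * q + r))))))%N => T C G R hR.
set n := #|T| => hn rn hd.
have hn1 : (2 * n1 <= n)%N by apply: leq_trans hn; apply: leq_addr.
have {}hn := leq_trans (leq_addl _ _) hn.
have {}hpow : (n ^ r <= 2 ^ (n %/ (B2 * q)))%N.
  by apply: hpow; apply: leq_trans hn; apply: leq_addr.
have {}hn := leq_trans (leq_addl _ _) hn.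
have nn3 : (n3 <= n)%N by apply: leq_trans hn; apply: leq_addr.
have {}hn := leq_trans (leq_addl _ _) hn.
have nB : (B <= n)%N by apply: leq_trans hn; apply: leq_addr.
have {}hn := leq_trans (leq_addl _ _) hn.
have nc0 : (B2 * c0 <= n)%N by apply: leq_trans hn; apply: leq_addr.
have {}hn := leq_trans (leq_addl _ _) hn.
have nBq : (B2 * q <= n)%N by apply: leq_trans hn; apply: leq_addr.
have nr := leq_trans (leq_addl _ _) hn; clear hn.
have npos : (0 < n)%N by apply: leq_trans nr.
have npos' : 0 < n%:R :> F by rewrite ltr0n.
have gn0 : 0 <= g * n%:R by rewrite mulr_ge0.
pose D := Num.truncn (g * n%:R).
have hDr : D%:R <= g * n%:R by rewrite truncn_le.
have hD : deficiency R [set: T] D.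
  by move=> v _; rewrite setTD truncn_ge_nat // hd.
pose b := (n %/ B)%N.
have b0 : (0 < b)%N by rewrite divn_gt0.
have bB : b%:R <= n%:R / B%:R :> F.
  by rewrite ler_pdivlMr // -natrM ler_nat leq_trunc_div.
have nb : (n <= 2 * B * b)%N.
  apply: (leq_trans (ltnW (ltn_ceil n (isT : (0 < B)%N)))).
  by rewrite -/b mulnAC leq_mul2r; apply/orP; right; rewrite mul2n -addnn -addn1 leq_add2l.
have room : (2 * D + b + ((r - 2) * (2 * (D + slack r) + b) + b) <= n)%N.
  have -> : (2 * D + b + ((r - 2) * (2 * (D + slack r) + b) + b) =
      (2 * r - 2) * D + (r * b + sl))%N.
    rewrite /sl (_ : (2 * r - 2 = 2 * (r - 2) + 2)%N); last by move: r1; clear; lia.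
    rewrite (_ : (r * b = (r - 2 + 2) * b)%N); last by rewrite subnK.
    by move: (r - 2)%N (slack r) => r' s'; ring.
  rewrite -(ler_nat F) natrD (natrD _ (r * b)) (natrM _ (2 * r - 2)) (natrM _ r b).
  have e1 : (2 * r - 2)%:R * D%:R <= (2 * r - 2)%:R * g * n%:R.
    by rewrite -mulrA ler_wpM2l.
  have e2 : r%:R * b%:R <= sg / 2 * n%:R.
    apply: (@le_trans _ _ (r%:R * (n%:R / B%:R))); first by rewrite ler_wpM2l.
    rewrite mulrA mulrAC ler_wpM2r // ler_pdivrMr //.
    move: B1; rewrite ler_pdivrMr // => B1; rewrite mulrAC ler_pdivlMr //.
    by rewrite mulrC [leRHS]mulrC.
  have e3 : sl%:R <= sg / 2 * n%:R.
    apply: (@le_trans _ _ (sg / 2 * n3%:R)); last by rewrite ler_wpM2l ?ler_nat // divr_ge0 // ltW.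
    by move: hn3; rewrite ler_pdivrMr // => hn3; rewrite mulrAC ler_pdivlMr // mulrC [leRHS]mulrC.
  apply: (le_trans (lerD e1 (lerD e2 e3))).
  by rewrite -mulrDl -mulrDl -splitr /sg addrC subrK mul1r.
pose k := (n %/ B2)%N.
have ck : (c0 <= k)%N by rewrite leq_divRL // mulnC.
have hk : (k * m + c0 <= b)%N.
  rewrite leq_divRL //; apply: leq_trans (leq_trunc_div n B2); rewrite -/k /B2.
  rewrite (_ : (k * (2 * m * B) = (k * m + k * m) * B)%N); last by ring.
  by rewrite leq_mul2r leq_add2l (leq_trans ck) ?orbT // leq_pmulr.
have [gs [sgs ugs tgs zgs pgs]] := absorbing_family F hR hD r1 b0 nr room hk.
pose V0 := [set z in flatten gs].
have cV0 : (#|V0| <= b)%N.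
  apply: leq_trans hk; apply: leq_trans (leq_addr _ _).
  rewrite cardsE; apply: (leq_trans (card_size _)).
  rewrite size_flatten /shape sumnE big_map -sgs.
  by apply: sum_seq_le => s sin; rewrite (eqP (allP zgs s sin)).
pose U := ~: V0.
have cU : (#|V0| + #|U| = n)%N by rewrite cardsC.
have hU : n%:R * (1 - B%:R^-1) <= #|U|%:R :> F.
  have cUr : n%:R = #|V0|%:R + #|U|%:R :> F by rewrite -natrD cU.
  rewrite mulrBr mulr1 lerBlDl {1}cUr lerD2r.
  by apply: le_trans bB; rewrite ler_nat.
have n1U : (n1 <= #|U|)%N.
  have bn2 : (2 * b <= n)%N.
    by apply: leq_trans (leq_trunc_div n B); rewrite -/b mulnC leq_mul2l orbT.
  by move: cU cV0 hn1 bn2; clear; lia.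
have dU : {in U, forall v, #|U :\: R v|%:R <= h * #|U|%:R}.
  move=> v _; apply: (@le_trans _ _ #|~: R v|%:R).
    by rewrite ler_nat; apply: subset_leq_card; apply/subsetP => z; rewrite !inE => /andP [].
  apply: (le_trans (hd v)).
  have h0 : 0 <= h by rewrite divr_ge0 // addr_ge0.
  apply: (le_trans _ (ler_wpM2l h0 hU)); rewrite mulrCA [leLHS]mulrC ler_wpM2l //.
  move: B2'; rewrite ler_pdivrMr // mulrC -ler_pdivrMr // => B2'.
  by rewrite mulrBr mulr1 /h; move: B2'; rewrite mulrDl; lra.
have [L [LU tUL cL]] := near _ _ _ _ _ hR n1U dU.
pose j := (k %/ q)%N.
have jE : j = (n %/ (B2 * q))%N by rewrite divnMA.
have Lj : (#|L| <= j)%N.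
  rewrite -(ler_nat F); apply: (le_trans cL).
  apply: (@le_trans _ _ (mu * n%:R)).
    by rewrite ler_wpM2l ?(ltW mu0) // ler_nat -cU leq_addl.
  rewrite /mu mulrC ler_pdivrMr; last by rewrite ltr0n muln_gt0 Bq0.
  rewrite -natrM ler_nat jE.
  have j1 : (0 < n %/ (B2 * q))%N by rewrite divn_gt0.
  apply: (leq_trans (ltnW (ltn_ceil n Bq0))); move: j1.
  move: (n %/ (B2 * q))%N => j' j1; move: (B2 * q)%N => P.
  rewrite (_ : (j' * (2 * P) = (j' + j') * P)%N); last by ring.
  by rewrite leq_mul2r -addn1 leq_add2l j1 orbT.
(* The total, the absorbing family and the tiled part all have size divisible by [r], so [L] can be
   cut into tuples of length [r]. *)
have rL : (r %| #|L|)%N.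
  have h1 := tileable_dvd tUL.
  have tV0 : tileable G r V0.
    have := @absorb_all T C G r [::] gs; rewrite cats0.
    move=> /(_ ugs tgs (fun l (lin : l \in [::]) => False_ind _ (notF lin))).
    by rewrite (_ : [set z in flatten [::]] = set0) ?setU0 //; apply/setP => z; rewrite !inE.
  have h2 := tileable_dvd tV0.
  have cUL : (#|L| + #|U :\: L| = #|U|)%N by rewrite -(cardsID L U) (setIidPr LU).
  move: rn; rewrite -/n -cU -cUL dvdn_addr // dvdn_addl //.
pose p := (#|L| %/ r)%N.
have pr : (p * r = #|L|)%N by rewrite divnK.
pose Ls := reshape (nseq p r) (enum L).
have szL : sumn (nseq p r) = size (enum L) by rewrite sumn_nseq mulnC pr -cardE.
have fL : flatten Ls = enum L by apply: reshapeKr; rewrite szL.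
have shL : shape Ls = nseq p r by apply: reshapeKl; rewrite szL.
have sLs : size Ls = p by rewrite -(size_map size) -/(shape Ls) shL size_nseq.
have rho1 : ((2 * B)%:R^-1) ^+ m <= (b%:R / n%:R) ^+ m :> F.
  rewrite lerXn2r ?nnegrE ?invr_ge0 ?divr_ge0 // ler_pdivlMr // mulrC.
  by rewrite ler_pdivrMr ?ltr0n ?muln_gt0 // -natrM ler_nat mulnC.
have rho2 : (b%:R / n%:R) ^+ m <= 1 :> F.
  by rewrite exprn_ile1 ?divr_ge0 // ler_pdivrMr // mul1r ler_nat leq_div.
have tVL : tileable G r (V0 :|: L).
  have -> : L = [set z in flatten Ls] by rewrite fL; apply/setP => z; rewrite inE mem_enum.
  apply: absorb_all => //.
    rewrite cat_uniq ugs fL enum_uniq andbT; apply/hasPn => z.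
    by rewrite mem_enum => /(subsetP LU); rewrite !inE.
  move=> l lin.
  have sl' : size l == r.
    have : size l \in shape Ls by apply: map_f.
    by rewrite shL => /nseqP [->].
  have ul : uniq l.
    have /perm_flatten pf := perm_to_rem lin.
    have : uniq (flatten Ls) by rewrite fL enum_uniq.
    by rewrite (perm_uniq pf) /= cat_uniq => /andP [].
  rewrite sLs; apply: (@leq_trans j).
    by apply: leq_trans Lj; apply: leq_div.
  suff : (j <= count (absorbs G r (Tuple sl')) gs)%N by [].
  apply: (absorbers_count pgs (c := 1 - x) (q := q) _ _ hq) => //.
  - by rewrite subr_ge0.
  - by rewrite lerB // /x ler_wpM2r // invr_ge0.
  - by rewrite mulnC leq_trunc_div.
  - by rewrite jE.
  - by rewrite subr_ge0 ler_pdivrMr // mul1r (le_trans rho2) // ler1n.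
  - by rewrite gerBl ltW.
have -> : [set: T] = (U :\: L) :|: (V0 :|: L).
  by apply/setP => z; rewrite !inE; case: (z \in L); case: (z \in flatten gs).
apply: tileableU => //; rewrite -setI_eq0; apply/eqP/setP => z; rewrite !inE.
by case: (z \in L); case: (z \in flatten gs).
Qed.

End Assembly.

(** * Degree thresholds and the final deduction *)

Lemma min_colour_degree_le (T : finType) (C : eqType) (G : ecgraph T C) v :
  (min_colour_degree G <= colour_degree G v)%N.
Proof.
rewrite /min_colour_degree; have := mem_index_enum v.
elim: (index_enum T) => // u s IH; rewrite inE big_cons geq_min.
by case/orP => [/eqP <-|/IH ->]; rewrite ?leqnn ?orbT.
Qed.

Lemma rainbow_stars_exist (T : finType) (C : eqType) (G : ecgraph T C) :
  exists2 R : T -> {set T}, rainbow_stars G R &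
    forall v, #|R v| = colour_degree G v.
Proof.
have [R hR] := fin_all_exists (rainbow_star_exists G).
exists R; last by move=> v; have [] := hR v.
by split=> v; have [] := hR v.
Qed.

Section Threshold.
Local Open Scope ring_scope.

(* For r = 4 the threshold of the theorem is slightly above 1 - 1/11. *)
Definition gap_threshold (F : realType) (r : nat) : F :=
  if r == 3%N then 6%:R^-1 else if r == 4%N then 11%:R^-1 else ((2 * r - 3) * r)%:R^-1.

Lemma gap_threshold_gt0 (F : realType) r : (2 < r)%N -> 0 < gap_threshold F r.
Proof.
move=> r2; rewrite /gap_threshold; case: ifP => _; first by rewrite invr_gt0 ltr0n.
case: ifP => _; rewrite invr_gt0 ltr0n // muln_gt0.
by apply/andP; split; lia.
Qed.

Lemma gap_threshold_le (F : realType) r : (2 < r)%N ->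
  (2 * r - 2)%:R * gap_threshold F r <= 1.
Proof.
move=> r2; rewrite /gap_threshold; case: ifP => [/eqP ->|_].
  by rewrite ler_pdivrMr // mul1r ler_nat.
case: ifP => [/eqP ->|_]; first by rewrite ler_pdivrMr // mul1r ler_nat.
rewrite ler_pdivrMr; last by rewrite ltr0n muln_gt0; apply/andP; split; lia.
by rewrite mul1r ler_nat; nia.
Qed.

Lemma balancing_below_threshold (F : realType) r (g : F) : (2 < r)%N ->
  g < gap_threshold F r -> balancing r g.
Proof.
move=> r2; rewrite /gap_threshold; case: ifP => [/eqP ->|_]; first exact: balancing_3.
case: ifP => [/eqP ->|_]; first exact: balancing_4.
by apply: balancing_general; apply: ltnW.
Qed.

(** The bound for [r = 4] divides [eps] by 5. There [28 / 11 <= sqrt (13 / 2)], since 784 / 121 is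
    below 13 / 2, and [(2 + 28 / 11) / 5 = 1 - 1 / 11]. *)
Lemma degree_bound_ge (F : realType) r (eps : F) n : (2 < r)%N -> 0 < eps ->
  (1 - gap_threshold F r + eps / 5) * n%:R <= degree_bound r eps n.
Proof.
move=> r2 eps0; rewrite /degree_bound /gap_threshold.
case: ifP => _; first by rewrite ler_wpM2r //; lra.
case: ifP => _; last first.
  rewrite ler_wpM2r // natrM natrB; last by lia.
  by rewrite natrM div1r; lra.
rewrite mulrAC ler_wpM2r //.
have : 28 / 11 <= Num.sqrt (13 / 2) :> F.
  have h : 0 <= 28 / 11 :> F by rewrite divr_ge0.
  by rewrite -(ger0_norm h) -sqrtr_sqr ler_wsqrtr //; lra.
by lra.
Qed.

End Threshold.

Local Open Scope ring_scope.

Theorem theorem1p5 (R : realType) (r : nat) (hr : (3 <= r)%N)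
    (eps : R) (heps : 0 < eps) :
  exists n0 : nat,
    forall (T : finType) (C : eqType) (G : ecgraph T C),
      (n0 <= #|T|)%N ->
      (r %| #|T|)%N ->
      degree_bound r eps #|T| <= (min_colour_degree G)%:R ->
      exists P : {set {set T}}, perfect_rainbow_Kr_tiling G r P.
Proof.
set t := gap_threshold R r; have t0 : 0 < t by apply: gap_threshold_gt0.
(* The minimum with [t] keeps [t - e] nonnegative; the value [t - e / 2] lies strictly between it
   and the threshold, as [tiling_of_balancing] requires. *)
pose e := Num.min (eps / 5) t; have e0 : 0 < e by rewrite lt_min divr_gt0.
have et : e <= t by rewrite ge_min lexx orbT.
have ee : e <= eps / 5 by rewrite ge_min lexx.
have g_ge0 : 0 <= t - e by rewrite subr_ge0.
have g_lt : t - e < t - e / 2 by lra.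
have g1_lt : t - e / 2 < t by lra.
have rg : (2 * r - 2)%:R * (t - e) < 1.
  apply: lt_le_trans (gap_threshold_le R hr); rewrite -/t ltr_pM2l; first by lra.
  by rewrite ltr0n subn_gt0; lia.
have bal := balancing_below_threshold hr g1_lt.
have [n0 hn0] := tiling_of_balancing (ltnW hr) g_ge0 g_lt rg bal.
exists n0 => T C G hn rn hdeg.
have [S hS cS] := rainbow_stars_exist G.
apply: tileable_perfect; apply: (hn0 _ _ _ S hS hn rn) => v.
have hv : (1 - t + eps / 5) * #|T|%:R <= #|S v|%:R.
  apply: (le_trans (degree_bound_ge _ hr heps)); apply: (le_trans hdeg).
  by rewrite ler_nat cS min_colour_degree_le.
have cT : #|S v|%:R + #|~: S v|%:R = #|T|%:R :> R by rewrite -natrD cardsC.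
have : (1 - t + e) * #|T|%:R <= (1 - t + eps / 5) * #|T|%:R.
  by rewrite ler_wpM2r // lerD2l.
move: hv cT; rewrite !mulrDl mulNr mul1r; lra.
Qed.
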